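(* There are universal constants $C,\widetilde{C}>0$, and for every $r>\frac12$ and $d\in\mathbb{N}$ a constant $C_{r,d}>0$, such that for all $r>\frac12$, $d\in\mathbb{N}$, and all $n,M\in\mathbb{N}$ with $M\ge3$, $$\varrho_{\lceil Cd\log(d+1)\,n\log(n+1)^2\log(M)\rceil}(\mathcal{A}^r_{\mathrm{mix}}(\mathbb{T}^d))_{L^2(\mathbb{T}^d)}\le\widetilde{C}\big(\sigma_n(\mathcal{A}^r_{\mathrm{mix}}(\mathbb{T}^d);\mathcal{T}^d)_{L^\infty(\mathbb{T}^d)}+M^{-r}\big),$$ and for all $n\in\mathbb{N}$ $$\varrho_{\lceil C_{r,d}\,n\log(n+1)^3\rceil}(\mathcal{A}^r_{\mathrm{mix}}(\mathbb{T}^d))_{L^2(\mathbb{T}^d)}\lesssim n^{-r-\frac12}\log(n+1)^{(d-1)r+\frac12}.$$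
   Context: $\mathbb{T}^d=\mathbb{R}^d/\mathbb{Z}^d$ with normalized Haar measure; $L^\infty(\mathbb{T}^d)$ is the space of bounded measurable functions with the supremum norm (no a.e. identification). $\widehat f(k)=\int_{\mathbb{T}^d}f(x)\mathrm{e}^{-2\pi\mathrm{i}\langle k,x\rangle}\,\mathrm{d}x$, and $\mathcal{T}^d=(\mathrm{e}^{2\pi\mathrm{i}\langle k,\cdot\rangle})_{k\in\mathbb{Z}^d}$. $\log$ is the natural logarithm. Weighted mixed Wiener space: $\mathcal{A}^r_{\mathrm{mix}}(\mathbb{T}^d)=\{f:\mathbb{T}^d\to\mathbb{C}:\|f\|_{\mathcal{A}^r_{\mathrm{mix}}(\mathbb{T}^d)}:=\sum_{k\in\mathbb{Z}^d}|\widehat f(k)|\prod_{j=1}^d(1+|k_j|)^r<\infty\}$; its elements are identified with their continuous representatives (their absolutely convergent Fourier series), so that point evaluations make sense. $\sigma_n(\mathcal{F};\mathcal{T}^d)_{L^\infty(\mathbb{T}^d)}=\sup_{\|f\|_{\mathcal{F}}\le1}\inf\{\|f-\sum_{k\in J}c_k\mathrm{e}^{2\pi\mathrm{i}\langle k,\cdot\rangle}\|_{L^\infty(\mathbb{T}^d)}:J\subset\mathbb{Z}^d,|J|\le n,(c_k)\in\mathbb{C}^J\}$. Sampling numbers: $\varrho_m(\mathcal{F})_X=\inf_{t_1,\ldots,t_m\in\mathbb{T}^d}\inf_{R:\mathbb{C}^m\to X}\sup_{\|f\|_{\mathcal{F}}\le1}\|f-R(f(t_1),\ldots,f(t_m))\|_X$,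 with $R$ ranging over all (not necessarily linear) maps. $a_n\lesssim b_n$ means $a_n\le c\,b_n$ for all $n\in\mathbb{N}$ with a constant $c>0$ independent of $n$ (it may depend on $r$ and $d$). *)

(* Defs.v *)
From HB Require Import structures.
From mathcomp Require Import all_boot all_order all_algebra.
From mathcomp Require Import finmap complex.
From mathcomp Require Import all_classical all_reals all_analysis.
From mathcomp Require Import summability.

Set Implicit Arguments.
Unset Strict Implicit.
Unset Printing Implicit Defensive.
Import Order.TTheory GRing.Theory Num.Theory.
Import numFieldNormedType.Exports.

Local Open Scope classical_set_scope.
Local Open Scope ring_scope.

(* The torus R^d / Z^d is represented by its covering space R^d: a function on
   the torus is a Z^d-periodic function on R^d (see [zperiodic]), a point of the
   torus is given by any of its representatives. *)
Notation pt R d := (d.-tuple (measurableTypeR R)).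
Notation freq d := (d.-tuple int).

Definition cons_pt (R : realType) (d : nat)
  (x : measurableTypeR R * pt R d) : pt R d.+1 :=
  [the d.+1.-tuple (measurableTypeR R) of x.1 :: x.2].

Lemma measurable_cons_pt (R : realType) (d : nat) :
  measurable_fun [set: measurableTypeR R * pt R d] (@cons_pt R d).
Proof. exact: measurable_cons. Qed.

HB.instance Definition _ (R : realType) (d : nat) :=
  isMeasurableFun.Build _ _ _ _ (@cons_pt R d) (@measurable_cons_pt R d).

(* Normalized Haar measure of the torus, carried by the fundamental domain
   [0,1]^d: the d-fold product of the uniform distribution on [0,1]. *)
Fixpoint haar (R : realType) (d : nat) : probability (pt R d) R :=
  match d return probability (pt R d) R with
  | 0%N => \d_([tuple] : pt R 0)
  | d'.+1 => distribution
      ((uniform_prob (@ltr01 R) \x haar R d')%E : probability _ R)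
      (@cons_pt R d')
  end.

Section Torus.
Context {R : realType}.

Definition zperiodic (d : nat) (f : pt R d -> R[i]) : Prop :=
  forall (x : pt R d) (k : freq d),
    f [tuple tnth x j + (tnth k j)%:~R | j < d] = f x.

Definition cmeasurable (d : nat) (f : pt R d -> R[i]) : Prop :=
  measurable_fun [set: pt R d] (fun x => complex.Re (f x)) /\
  measurable_fun [set: pt R d] (fun x => complex.Im (f x)).

(* |z| as a real number; the norm [`|z|] of [R[i]] takes its values in R[i]. *)
Definition cabs (z : R[i]) : R :=
  Num.sqrt (complex.Re z ^+ 2 + complex.Im z ^+ 2).

Definition cintegrable (d : nat) (f : pt R d -> R[i]) : Prop :=
  (haar R d).-integrable [set: pt R d] (EFin \o (fun x => complex.Re (f x))) /\
  (haar R d).-integrable [set: pt R d] (EFin \o (fun x => complex.Im (f x))).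

Definition cintegral (d : nat) (f : pt R d -> R[i]) : R[i] :=
  Complex (\int[haar R d]_x complex.Re (f x))%R
          (\int[haar R d]_x complex.Im (f x))%R.

Definition expi (t : R) : R[i] := Complex (cos t) (sin t).

Definition dotp (d : nat) (k : freq d) (x : pt R d) : R :=
  \sum_(j < d) (tnth k j)%:~R * tnth x j.

Definition character (d : nat) (k : freq d) (x : pt R d) : R[i] :=
  expi (2 * pi * dotp k x).

Definition fourier (d : nat) (f : pt R d -> R[i]) (k : freq d) : R[i] :=
  cintegral (fun x => f x * expi (- (2 * pi * dotp k x))).

Definition trig_sum (d : nat) (c : freq d -> R[i]) (J : {fset freq d})
  (x : pt R d) : R[i] := \sum_(k <- J) c k * character k x.

Definition wiener_norm (r : R) (d : nat) (f : pt R d -> R[i]) : \bar R :=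
  \esum_(k in [set: freq d])
    (cabs (fourier f k) *
     \prod_(j < d) (1 + `|(tnth k j)%:~R|) `^ r)%:E.

(* The last clause picks the continuous representative: f is, at every point,
   the (unordered, absolutely convergent) sum of its Fourier series. *)
Definition wiener_mix (r : R) (d : nat) : set (pt R d -> R[i]) :=
  [set f | [/\ zperiodic f, cintegrable f,
               (wiener_norm r f < +oo)%E &
               forall x : pt R d,
                 trig_sum (fourier f) J x @[J --> totally] -->
                   (f x : R[i]^o)]].

Definition wiener_ball (r : R) (d : nat) : set (pt R d -> R[i]) :=
  wiener_mix r (d := d) `&` [set f | (wiener_norm r f <= 1)%E].

(* Supremum, not essential supremum. *)
Definition Linf_norm (d : nat) (g : pt R d -> R[i]) : \bar R :=
  ereal_sup (range (fun x => (cabs (g x))%:E)).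

Definition L2_norm (d : nat) (g : pt R d -> R[i]) : \bar R :=
  Lnorm (haar R d) 2%:E (fun x => (cabs (g x))%:E).

Definition L2 (d : nat) : set (pt R d -> R[i]) :=
  [set g | [/\ zperiodic g, cmeasurable g & (L2_norm g < +oo)%E]].

(* sigma_n(F; T^d) in L^infty, for a class given by its unit ball F. *)
Definition best_n_term (d n : nat) (F : set (pt R d -> R[i])) : \bar R :=
  ereal_sup
    [set ereal_inf
       [set Linf_norm (fun x => f x - trig_sum Jc.2 Jc.1 x) |
         Jc in [set Jc : {fset freq d} * (freq d -> R[i]) |
                 (#|` Jc.1| <= n)%N]]
    | f in F].

(* rho_m(F)_X, for a class given by its unit ball F and a target space given by
   its set X of functions and its norm. *)
Definition sampling_number (d m : nat) (F X : set (pt R d -> R[i]))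
    (normX : (pt R d -> R[i]) -> \bar R) : \bar R :=
  ereal_inf
    [set ereal_inf
       [set ereal_sup
          [set normX (fun x => f x - Rec [tuple f (tnth t i) | i < m] x) |
            f in F]
       | Rec in [set Rec : m.-tuple R[i] -> pt R d -> R[i] |
                  forall y, X (Rec y)]]
    | t in [set: m.-tuple (pt R d)]].

(* Only used for x >= 0. *)
Definition nat_ceil (x : R) : nat := `|Num.ceil x|%N.

End Torus.

Arguments wiener_mix {R} r d.
Arguments wiener_ball {R} r d.
Arguments L2_norm {R} d g.
Arguments L2 {R} d.

(* Main.v *)
Require Import Defs.
From mathcomp Require Import all_boot all_order all_algebra.
From mathcomp Require Import all_classical all_reals all_analysis.
From mathcomp Require Import finmap complex summability measurable_realfun.
From mathcomp Require Import ring lra zify.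

(** Reconstruct from samples by choosing any function of the unit ball with the
    observed values.  The error is then at most the largest L2 norm of a
    difference h of two ball functions that vanishes at the sampling points.

    Everything is transported to the grid of points with coordinates in
    (1/Q)Z, Q = 2M+1.  There an n-term trigonometric polynomial with arbitrary
    frequencies becomes, by aliasing, an n-sparse combination of the N = Q^d
    characters with frequencies in [-M, M]^d, and the part of h outside this box
    costs only M^-r.  So it suffices to find about n log(n)^2 log(N) grid points
    such that an n-sparse combination P bounded by eta at these points has
    quadratic mean O(eta) over the grid.

    Normalise the l1 norm of the coefficients of P to 1.  One of O(log n)
    dyadic level sets {|P| >= 2^-i} is large.  By Maurey's argument an average
    of about 4^i log(m) signed characters is close to P at all m sampling points
    and on half of that level set.  There are few such averages, so random
    sampling points hit all their large level sets simultaneously, and at such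
    a hit P itself is large.  The factor log(m) contains log log M; it is
    harmless because sigma_n >= (n+1)^(-1-r) allows one to replace M by
    min(M, (n+1)^3).

    For the second bound, keep the coefficients in a hyperbolic cross of about n
    frequencies and apply Maurey's argument once more, at all grid points, to the
    remaining ones, whose l1 norm is small. *)

Set Implicit Arguments.
Unset Strict Implicit.
Unset Printing Implicit Defensive.
Import Order.TTheory GRing.Theory Num.Theory.
Import numFieldNormedType.Exports.
Local Open Scope ring_scope.

(** * Maurey's empirical method and hitting sets *)

Section Maurey.
Context {R : realType}.

(** Multiply by [1 - y], which is at most [expR (- y)]: the right side becomes 1 + y^2 (1 - 2y), and
    this is at least 1. *)
Lemma expR_le_quadratic (y : R) : y <= 2^-1 -> expR y <= 1 + y + 2 * y ^+ 2.
Proof.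
move=> hy; have y1 : 0 < 1 - y by lra.
rewrite -(ler_pM2l y1).
apply: (@le_trans _ _ (expR (- y) * expR y)).
  by rewrite ler_wpM2r ?expR_ge0 // expR_ge1Dx.
rewrite -expRD addNr expR0.
have : 0 <= y ^+ 2 * (1 - 2 * y) by apply: mulr_ge0; [exact: sqr_ge0|lra].
nra.
Qed.

(** Distributivity. With g a probability vector, the products are the law of [s] independent draws,
    so this identity plays the role of independence in the counting arguments below. *)
Lemma sum_ffun_prod (I : finType) (s : nat) (g : I -> R) :
  \sum_(w : {ffun 'I_s -> I}) \prod_l g (w l) = (\sum_i g i) ^+ s.
Proof.
by rewrite -(bigA_distr_bigA (fun _ i => g i)) prodr_const card_ord.
Qed.

(** Averaging [expR_le_quadratic] at [lam * f i], which is at most 1/2, kills the linear term since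
    f has mean 0; the quadratic term is at most 8 lam^2. *)
Lemma mgf_centered (I : finType) (p f : I -> R) (lam : R) :
  (forall i, 0 <= p i) -> \sum_i p i = 1 -> \sum_i p i * f i = 0 ->
  (forall i, `|f i| <= 2) -> 0 <= lam <= 4^-1 ->
  \sum_i p i * expR (lam * f i) <= expR (8 * lam ^+ 2).
Proof.
move=> p0 p1 pf f2 /andP[l0 l4].
apply: (@le_trans _ _ (1 + 8 * lam ^+ 2)); last exact: expR_ge1Dx.
have -> : 1 + 8 * lam ^+ 2 =
    \sum_i p i * (1 + lam * f i + 8 * lam ^+ 2).
  under eq_bigr do rewrite !mulrDr mulr1 mulrCA.
  by rewrite !big_split /= -mulr_sumr pf mulr0 addr0 -mulr_suml p1 mul1r.
apply: ler_sum => i _; rewrite ler_wpM2l//.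
have := f2 i; rewrite ler_norml => /andP[fl fu].
apply: le_trans (expR_le_quadratic _) _; first by nra.
rewrite lerD2l exprMn.
have : f i ^+ 2 <= 4 by nra.
have := sqr_ge0 lam; nra.
Qed.

Lemma chernoff_one_sided (I : finType) (p f : I -> R) (s : nat) (delta : R) :
  (forall i, 0 <= p i) -> \sum_i p i = 1 -> \sum_i p i * f i = 0 ->
  (forall i, `|f i| <= 2) -> 0 <= delta <= 4 ->
  \sum_(w : {ffun 'I_s -> I})
     (\prod_l p (w l)) * (s%:R * delta < \sum_l f (w l))%R%:R
  <= expR (- (s%:R * delta ^+ 2 / 32)).
Proof.
move=> p0 p1 pf f2 /andP[d0 d4].
(* Exponential Markov inequality: the exponent s (8 lam^2 - lam delta) is smallest at this [lam],
   with value - s delta^2 / 32. The bound [delta <= 4] gives [lam <= 4^-1]. *)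
pose lam := delta / 16.
apply: (@le_trans _ _ (expR (- (lam * (s%:R * delta))) *
    \sum_(w : {ffun 'I_s -> I}) \prod_l (p (w l) * expR (lam * f (w l))))).
  rewrite mulr_sumr; apply: ler_sum => w _.
  rewrite big_split /= mulrCA ler_wpM2l ?prodr_ge0//.
  rewrite -expR_sum -expRD -mulr_sumr addrC -mulrBr.
  case: ltP => /= [lt|_]; last exact: expR_ge0.
  apply: le_trans (expR_ge1Dx _).
  by rewrite lerDl mulr_ge0 ?subr_ge0 ?(ltW lt)// /lam; lra.
rewrite (sum_ffun_prod s (fun i => p i * expR (lam * f i))).
apply: (@le_trans _ _ (expR (- (lam * (s%:R * delta))) * expR (8 * lam ^+ 2) ^+ s)).
  rewrite ler_wpM2l ?expR_ge0// lerXn2r ?nnegrE ?expR_ge0//.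
    by rewrite sumr_ge0// => i _; rewrite mulr_ge0 ?expR_ge0.
  by apply: mgf_centered => //; rewrite /lam; lra.
rewrite -expRM_natl -expRD ler_expR /lam -mulr_natl.
by rewrite le_eqVlt; apply/orP; left; apply/eqP; field.
Qed.

Lemma chernoff_two_sided (I : finType) (p f : I -> R) (s : nat) (delta : R) :
  (forall i, 0 <= p i) -> \sum_i p i = 1 -> \sum_i p i * f i = 0 ->
  (forall i, `|f i| <= 2) -> 0 <= delta <= 4 ->
  \sum_(w : {ffun 'I_s -> I})
     (\prod_l p (w l)) * (s%:R * delta < `|\sum_l f (w l)|)%R%:R
  <= 2 * expR (- (s%:R * delta ^+ 2 / 32)).
Proof.
move=> p0 p1 pf f2 d04; rewrite mulrDl mul1r.
have up := chernoff_one_sided s p0 p1 pf f2 d04.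
have lo : \sum_(w : {ffun 'I_s -> I}) (\prod_l p (w l)) *
    (s%:R * delta < \sum_l - f (w l))%R%:R <= expR (- (s%:R * delta ^+ 2 / 32)).
  apply: (@chernoff_one_sided _ p (fun i => - f i)) => //; last by move=> i; rewrite normrN.
  by under eq_bigr do rewrite mulrN; rewrite sumrN pf oppr0.
apply: le_trans (lerD up lo); rewrite -big_split /=; apply: ler_sum => w _.
rewrite -mulrDr ler_wpM2l ?prodr_ge0// sumrN ltr_normr -natrD ler_nat.
by case: (_ < _); case: (_ < _).
Qed.

(** Probabilistic method: draw [s] indices independently with law [p]. By the two-sided Chernoff
    bound at each point, the expected [q]-weight of the badly approximated points is below 1, so
    some word [w] has bad weight below 1. The choice of [q] decides which points must be good. *)
Lemma maurey_approx (I X : finType) (phi : I -> X -> R) (p : I -> R)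
    (q : X -> R) (s : nat) (delta : R) :
  (forall i x, `|phi i x| <= 1) -> (forall i, 0 <= p i) -> \sum_i p i = 1 ->
  (forall x, 0 <= q x) -> (0 < s)%N -> 0 <= delta <= 4 ->
  (\sum_x q x) * (2 * expR (- (s%:R * delta ^+ 2 / 32))) < 1 ->
  exists w : {ffun 'I_s -> I},
    \sum_x q x * (delta < `|s%:R^-1 * (\sum_l phi (w l) x)
                            - \sum_i p i * phi i x|)%R%:R < 1.
Proof.
move=> phi1 p0 p1 q0 s0 d04 small.
pose h x := \sum_i p i * phi i x.
pose bad (w : {ffun 'I_s -> I}) x : R := (s%:R * delta < `|\sum_l (phi (w l) x - h x)|)%R%:R.
have h1 x : `|h x| <= 1.
  rewrite (le_trans (ler_norm_sum _ _ _))// -p1; apply: ler_sum => i _.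
  by rewrite normrM (ger0_norm (p0 i)) ler_piMr.
have badE w x : bad w x = (delta < `|s%:R^-1 * (\sum_l phi (w l) x) - h x|)%R%:R.
  congr ((_ : bool)%:R); have s0' : 0 < s%:R :> R by rewrite ltr0n.
  rewrite sumrB sumr_const card_ord -[h x *+ s]mulr_natl.
  have -> : \sum_l phi (w l) x - s%:R * h x =
      s%:R * (s%:R^-1 * (\sum_l phi (w l) x) - h x).
    by rewrite mulrBr mulrA divff ?mul1r// gt_eqF.
  by rewrite normrM gtr0_norm// ltr_pM2l.
suff [w hw] : exists w, \sum_x q x * bad w x < 1.
  by exists w; under eq_bigr do rewrite -badE.
apply: contrapT => /forallNP noW.
have : 1 <= \sum_(w : {ffun 'I_s -> I}) (\prod_l p (w l)) * \sum_x q x * bad w x.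
  rewrite -[leLHS](expr1n _ s) -{1}p1 -sum_ffun_prod.
  apply: ler_sum => w _; rewrite ler_peMr ?prodr_ge0//.
  by rewrite leNgt; apply/negP; exact: noW.
apply/negP; rewrite -ltNge; apply: le_lt_trans small.
under eq_bigr do rewrite mulr_sumr.
rewrite exchange_big /= mulr_suml; apply: ler_sum => x _.
under eq_bigr do rewrite mulrCA.
rewrite -mulr_sumr ler_wpM2l//.
apply: (@chernoff_two_sided _ p (fun i => phi i x - h x)) => //.
- under eq_bigr do rewrite mulrBr.
  by rewrite sumrB -mulr_suml p1 mul1r subrr.
- by move=> i; rewrite (le_trans (ler_normB _ _))// -[2]/(1 + 1) lerD.
Qed.

(** Of [m] independent uniform points, none falls into a set of density at least [e w] with
    probability at most (1 - e w)^m, which is at most [expR (- (m%:R * e w))]. A union bound over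
    [W] leaves a good sequence. *)
Lemma exists_hitting_sequence (X W : finType) (S : W -> {set X}) (e : W -> R)
    (m : nat) :
  (0 < #|X|)%N -> \sum_w expR (- (m%:R * e w)) < 1 ->
  exists T : {ffun 'I_m -> X},
    forall w, e w * #|X|%:R <= #|S w|%:R -> exists k, T k \in S w.
Proof.
move=> X0 small.
pose miss (T : {ffun 'I_m -> X}) w : R :=
  (e w * #|X|%:R <= #|S w|%:R)%R%:R * \prod_k (T k \notin S w)%:R.
have X0' : 0 < #|X|%:R :> R by rewrite ltr0n.
suff [T hT] : exists T, \sum_w miss T w < 1.
  exists T => w le; apply: contrapT => /forallNP noK.
  have : miss T w <= \sum_w miss T w.
    rewrite (bigD1 w)//= lerDl sumr_ge0// => w' _.
    by rewrite mulr_ge0// prodr_ge0.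
  rewrite {1}/miss le mul1r big1; first by move/le_lt_trans/(_ hT); rewrite ltxx.
  by move=> k _; move/negP: (noK k) => ->.
apply: contrapT => /forallNP noT.
have : #|X|%:R ^+ m <= \sum_(T : {ffun 'I_m -> X}) \sum_w miss T w.
  apply: (@le_trans _ _ (\sum_(T : {ffun 'I_m -> X}) (1 : R))).
    by rewrite sumr_const card_ffun card_ord natrX.
  by apply: ler_sum => T _; rewrite leNgt; apply/negP; exact: noT.
apply/negP; rewrite -ltNge exchange_big /=.
move: small; rewrite -(ltr_pM2l (exprn_gt0 m X0')) mulr1; apply: le_lt_trans.
rewrite mulr_sumr; apply: ler_sum => w _.
rewrite -mulr_sumr (sum_ffun_prod m (fun x => (x \notin S w)%:R)).
case: (leP (e w * _)) => /= le; last by rewrite mul0r mulr_ge0 ?exprn_ge0 ?expR_ge0 ?ltW.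
rewrite mul1r -mulrN expRM_natl -exprMn lerXn2r ?nnegrE ?sumr_ge0 ?mulr_ge0 ?expR_ge0 ?(ltW X0')//.
apply: (@le_trans _ _ (#|X|%:R * (1 - e w))); last first.
  by rewrite ler_wpM2l ?expR_ge1Dx// ltW.
have -> : \sum_x (x \notin S w)%:R = #|X|%:R - #|S w|%:R :> R.
  rewrite -(cardsC (S w)) natrD addrAC subrr add0r -sum1_card natr_sum.
  by rewrite [RHS]big_mkcond; apply: eq_bigr => x _; rewrite inE; case: (x \in S w).
by rewrite mulrBr mulr1 lerD2l lerN2 mulrC.
Qed.

(** Let q be the mean of h^2. Points with h^2 at most q/2 contribute at most half of the sum. The
    others lie in dyadic levels comparable to q or higher; if all of these were small, they would
    contribute less than 4^-J per point on average, which is at most the other half. *)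
Lemma large_level_set (X : finType) (h : X -> R) (J : nat) :
  (0 < J)%N -> (0 < #|X|)%N -> (forall x, h x ^+ 2 <= 1) ->
  2 * 4^-1 ^+ J * #|X|%:R <= \sum_x h x ^+ 2 ->
  exists2 i : 'I_J, \sum_x h x ^+ 2 <= 8 * 4^-1 ^+ i.+1 * #|X|%:R &
    4 ^+ i.+1 / (4 * J%:R * 4 ^+ J) * #|X|%:R <=
    #|[set x | (4^-1 ^+ i.+1 <= h x ^+ 2)%R]|%:R :> R.
Proof.
move=> J0 X0 h1 qJ; apply: contrapT => noI.
set Q := \sum_x h x ^+ 2 in qJ noI.
have X0' : 0 < #|X|%:R :> R by rewrite ltr0n.
pose q := Q / #|X|%:R.
have QE : Q = q * #|X|%:R by rewrite /q mulfVK ?gt_eqF.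
have qJ' : 2 * 4^-1 ^+ J <= q by move: qJ; rewrite QE ler_pM2r.
pose E i := [set x | (4^-1 ^+ i.+1 <= h x ^+ 2)%R].
have J0' : 0 < J%:R :> R by rewrite ltr0n.
have p4 k : 0 < 4 ^+ k :> R by rewrite exprn_gt0.
have p4' k : 0 < 4^-1 ^+ k :> R by rewrite exprn_gt0.
have E4 (i : 'I_J) : q <= 8 * 4^-1 ^+ i.+1 ->
    4 * 4^-1 ^+ i.+1 * #|E i|%:R < (J%:R * 4 ^+ J)^-1 * #|X|%:R :> R.
  move=> qi; rewrite ltNge; apply/negP => hE; apply: noI; exists i.
    by rewrite QE ler_pM2r.
  have pp : 0 < 4 * 4^-1 ^+ i.+1 :> R by rewrite mulr_gt0.
  rewrite -(ler_pM2l pp).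
  apply: le_trans hE; rewrite mulrA ler_pM2r//.
  rewrite le_eqVlt; apply/orP; left; apply/eqP.
  rewrite exprVn; field.
  by rewrite !gt_eqF.
have pw x : h x ^+ 2 <= q / 2 + \sum_(i < J | q <= 8 * 4^-1 ^+ i.+1)
    4 * 4^-1 ^+ i.+1 * (x \in E i)%:R :> R.
  have pos : 0 <= \sum_(i < J | q <= 8 * 4^-1 ^+ i.+1)
      4 * 4^-1 ^+ i.+1 * (x \in E i)%:R :> R.
    by apply: sumr_ge0 => i _; rewrite mulr_ge0// ltW// mulr_gt0.
  have [|hq] := leP (h x ^+ 2) (q / 2); first by move/le_trans; apply; rewrite lerDl.
  have hJ : 4^-1 ^+ J < h x ^+ 2 by lra.
  have ex : exists k, 4^-1 ^+ k <= h x ^+ 2 by exists J; rewrite ltW.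
  (* The least such k locates h^2 between 4^-k and 4 * 4^-k. There is no level k = 0: it forces h^2
     = 1, and such points are counted in the first level, where the factor 4 * 4^-1 is exactly 1. *)
  case: (ex_minnP ex) => -[|i] hi mini.
    have -> : h x ^+ 2 = 1 by apply/eqP; rewrite eq_le h1.
    have h0 : q <= 8 * 4^-1 ^+ (Ordinal J0).+1.
      have : q <= 1.
        rewrite /q ler_pdivrMr// mul1r /Q -sum1_card natr_sum.
        by apply: ler_sum => y _.
      by rewrite expr1; lra.
    rewrite (bigD1 (Ordinal J0))//= inE expr1.
    have -> /= : 4^-1 <= h x ^+ 2 by rewrite expr0 in hi; lra.
    rewrite mulr1 mulfV// addrCA lerDl addr_ge0//.
      by have := p4' J; lra.
    by apply: sumr_ge0 => j _; rewrite mulr_ge0// ltW// mulr_gt0.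
  have iJ : (i < J)%N.
    by apply: mini; exact: ltW.
  have hi4 : h x ^+ 2 < 4 * 4^-1 ^+ i.+1.
    have -> : 4 * 4^-1 ^+ i.+1 = 4^-1 ^+ i :> R by rewrite exprS mulrA mulfV// mul1r.
    rewrite ltNge; apply/negP => /mini.
    by rewrite ltnn.
  rewrite (bigD1 (Ordinal iJ))/=; last by lra.
  rewrite inE hi mulr1 addrCA; apply: le_trans (ltW hi4) _; rewrite lerDl addr_ge0//.
    by have := p4' J; lra.
  by apply: sumr_ge0 => j _; rewrite mulr_ge0// ltW// mulr_gt0.
have : Q <= q / 2 * #|X|%:R + \sum_(i < J | q <= 8 * 4^-1 ^+ i.+1)
    4 * 4^-1 ^+ i.+1 * #|E i|%:R.
  apply: (@le_trans _ _ (\sum_x (q / 2 + \sum_(i < J | q <= 8 * 4^-1 ^+ i.+1)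
    4 * 4^-1 ^+ i.+1 * (x \in E i)%:R))); first exact: ler_sum.
  rewrite big_split /= sumr_const mulr_natr lerD2l exchange_big /=.
  apply: ler_sum => i _; rewrite -mulr_sumr -sum1_card natr_sum [in leRHS]big_mkcond /=.
  by under eq_bigr do rewrite mulrb.
have S1 : \sum_(i < J | q <= 8 * 4^-1 ^+ i.+1) 4 * 4^-1 ^+ i.+1 * #|E i|%:R <
    4^-1 ^+ J * #|X|%:R :> R.
  have -> : 4^-1 ^+ J * #|X|%:R = \sum_(i < J) (J%:R * 4 ^+ J)^-1 * #|X|%:R :> R.
    rewrite sumr_const card_ord -mulr_natl exprVn; field.
    by rewrite !gt_eqF.
  rewrite big_mkcond /=; apply: ltr_sum.
    by apply/hasP; exists (Ordinal J0) => //; rewrite mem_index_enum.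
  move=> i _; case: ifP => [/E4//|_].
  by rewrite mulr_gt0// invr_gt0 mulr_gt0.
move: qJ; rewrite QE; lra.
Qed.

End Maurey.

(** * Points hitting the large level sets of all convex combinations *)

Section Hitting.
Context {R : realType}.

Lemma expR1_pow2 (n : nat) : 2 ^+ n <= expR n%:R :> R.
Proof.
rewrite -[n%:R]mulr1 expRM_natl lerXn2r ?nnegrE ?expR_ge0//.
by rewrite (le_trans _ (expR_ge1Dx _)).
Qed.

Lemma sum_half_lt1 (J : nat) : \sum_(i < J) 2^-1 ^+ i.+1 < 1 :> R.
Proof.
suff -> : \sum_(i < J) 2^-1 ^+ i.+1 = 1 - 2^-1 ^+ J :> R.
  by rewrite ltrBlDr ltrDl exprn_gt0.
elim: J => [|J IH]; first by rewrite big_ord0 expr0 subrr.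
by rewrite big_ord_recr /= IH exprS; lra.
Qed.

(** The points must serve all weights [p] at once, and these form a continuum. The union bound is
    therefore taken over the finitely many Maurey averages, whose level sets [T] is made to hit; a
    given combination is then compared with an average that is close to it both on its own level set
    and at the points of [T]. *)
Lemma exists_hitting_points (I X : finType) (phi : I -> X -> R) (J m l b : nat) :
  (0 < #|X|)%N -> (0 < J)%N -> (forall i x, `|phi i x| <= 1) ->
  (#|I| <= 2 ^ b)%N -> (2 * (m + 2) < 2 ^ l)%N ->
  (8 * J * 4 ^ J * (512 * l * b + 1) <= m)%N ->
  exists T : {ffun 'I_m -> X}, forall p : I -> R,
    (forall i, 0 <= p i) -> \sum_i p i = 1 ->
    2 * 4^-1 ^+ J * #|X|%:R <= \sum_x (\sum_i p i * phi i x) ^+ 2 ->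
    exists k, \sum_x (\sum_i p i * phi i x) ^+ 2 <=
              32 * #|X|%:R * (\sum_i p i * phi i (T k)) ^+ 2.
Proof.
move=> X0 J0 phi1 Ib ml mJ.
have l0 : (0 < l)%N by case: l ml {mJ} => //; rewrite expn0; lia.
have X0' : 0 < #|X|%:R :> R by rewrite ltr0n.
have J0' : 0 < J%:R :> R by rewrite ltr0n.
have p4 k : 0 < 4 ^+ k :> R by rewrite exprn_gt0.
have p4' k : 0 < 4^-1 ^+ k :> R by rewrite exprn_gt0.
have p2' k : 0 < 2^-1 ^+ k :> R by rewrite exprn_gt0.
(* Since 512 = 16 * 32, accuracy [delta] equal to a quarter of the level 2^-(i+1) makes the Chernoff
   exponent s delta^2 / 32 exactly [l]. *)
pose s i := (4 ^ i.+1 * (512 * l))%N.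
have s0 i : (0 < s i)%N by rewrite !muln_gt0 expn_gt0 l0.
pose W := {i : 'I_J & {ffun 'I_(s i) -> I}}.
pose avg i (w : {ffun 'I_(s i) -> I}) x : R := (s i)%:R^-1 * \sum_l phi (w l) x.
(* An approximation error of a quarter level takes values of at least one level to 3/4 of it, and
   back from 3/4 to 1/2. *)
pose S (w : W) := [set x | (3 / 4 * 2^-1 ^+ (tag w).+1 <= `|avg _ (tagged w) x|)%R].
(* Half of the density provided by [large_level_set], because up to half of the level set may be
   bad. *)
pose e (w : W) : R := 4 ^+ (tag w).+1 / (8 * J%:R * 4 ^+ J).
have small : \sum_w expR (- (m%:R * e w)) < 1.
  rewrite -(sig_big_dep xpredT (fun _ => xpredT)
    (fun (i : 'I_J) (w : {ffun 'I_(s i) -> I}) =>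
       expR (- (m%:R * (4 ^+ i.+1 / (8 * J%:R * 4 ^+ J)))))) /=.
  apply: le_lt_trans (sum_half_lt1 J); apply: ler_sum => i _.
  rewrite sumr_const card_ffun card_ord -[leLHS]mulr_natl.
  (* There are at most 2^(b s_i) words of level i. The hypothesis on [m] beats this number and
     leaves the factor exp(- 4^(i+1)), so the levels sum to less than 1. *)
  apply: (@le_trans _ _ (expR (b * s i)%:R * expR (- (4 ^+ i.+1 * (512 * l * b + 1)%:R)))).
    apply: ler_pM; rewrite ?expR_ge0//.
      apply: le_trans (expR1_pow2 _).
      by rewrite -natrX ler_nat expnM leq_exp2r.
    rewrite ler_expR lerN2 mulrCA ler_pM2l// ler_pdivlMr.
      by rewrite -natrX -!natrM ler_nat mulnC.
    by rewrite !mulr_gt0.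
  rewrite -expRD /s -natrX -natrM.
  have -> : (b * (4 ^ i.+1 * (512 * l)))%:R - (4 ^ i.+1 * (512 * l * b + 1))%:R =
      - (4 ^ i.+1)%:R :> R.
    rewrite !natrM !natrD !natrM; ring.
  rewrite expRN exprVn lef_pV2 ?posrE ?expR_gt0 ?exprn_gt0//.
  apply: le_trans (expR1_pow2 _) _; rewrite ler_expR ler_nat.
  by apply: ltnW; exact: ltn_expl.
have [T hT] := exists_hitting_sequence S X0 small.
exists T => p p0 p1 large.
pose h x := \sum_i p i * phi i x.
have h1 x : `|h x| <= 1.
  rewrite (le_trans (ler_norm_sum _ _ _))// -p1; apply: ler_sum => i _.
  by rewrite normrM (ger0_norm (p0 i)) ler_piMr.
have [|i qi Ei] := large_level_set J0 X0 _ large.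
  move=> x; rewrite -real_normK ?num_real// expr_le1//; exact: h1.
set E := finset _ in Ei.
have E0 : 0 < #|E|%:R :> R.
  by apply: lt_le_trans Ei; rewrite mulr_gt0// divr_gt0 ?mulr_gt0.
pose delta : R := 4^-1 * 2^-1 ^+ i.+1.
(* With these weights, a total bad weight below 1 means that no sampling point
   and less than half of E is bad. *)
pose q x : R := \sum_k (T k == x)%:R + 2 / #|E|%:R * (x \in E)%:R.
have q0 x : 0 <= q x.
  by rewrite addr_ge0 ?sumr_ge0// mulr_ge0// divr_ge0.
have d04 : 0 <= delta <= 4.
  have hz : 2^-1 ^+ i.+1 <= 1 :> R by rewrite exprn_ile1//; lra.
  by move: (p2' i.+1) hz; rewrite /delta; move: (2^-1 ^+ i.+1) => z; lra.
have qsum : \sum_x q x = m%:R + 2.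
  rewrite big_split /= exchange_big /= -mulr_sumr; congr (_ + _).
    rewrite -[in RHS](card_ord m) -sum1_card natr_sum; apply: eq_bigr => k _.
    rewrite (bigD1 (T k))//= eqxx big1 ?addr0// => x /negbTE.
    by rewrite eq_sym => ->.
  under eq_bigr do rewrite mulrb.
  by rewrite -big_mkcond sumr_const mulfVK// gt_eqF.
have qsmall : (\sum_x q x) * (2 * expR (- ((s i)%:R * delta ^+ 2 / 32))) < 1.
  have -> : (s i)%:R * delta ^+ 2 / 32 = l%:R.
    rewrite /s /delta !natrM natrX exprMn -exprM mulnC exprM.
    have -> : 2^-1 ^+ 2 = 4^-1 :> R by lra.
    have : 4 ^+ i.+1 * 4^-1 ^+ i.+1 = 1 :> R by rewrite -exprMn mulfV ?expr1n.
    move: (4 ^+ i.+1) (4^-1 ^+ i.+1) => u v uv.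
    by transitivity (u * v * l%:R); [field|rewrite uv mul1r].
  rewrite qsum expRN mulrA ltr_pdivrMr ?expR_gt0// mul1r.
  apply: lt_le_trans (expR1_pow2 _).
  by rewrite -natrD -natrM -natrX ltr_nat mulnC.
have [w hw] := maurey_approx phi1 p0 p1 q0 (s0 i) d04 qsmall.
pose bad x := (delta < `|avg i w x - h x|).
have {}hw : \sum_x q x * (bad x)%:R < 1 by [].
have goodT k : ~~ bad (T k).
  apply/negP => bk; move: hw; rewrite ltNge => /negP; apply.
  have qk : 1 <= q (T k).
    rewrite /q (bigD1 k)//= eqxx -addrA lerDl; apply: addr_ge0; first exact: sumr_ge0.
    by rewrite mulr_ge0// divr_ge0.
  rewrite (bigD1 (T k))//= bk mulr1; apply: le_trans qk _.
  by rewrite lerDl sumr_ge0// => x _; rewrite mulr_ge0.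
have badE : 2 * #|E :&: [set x | bad x]|%:R <= #|E|%:R :> R.
  suff : 2 / #|E|%:R * #|E :&: [set x | bad x]|%:R <= 1 :> R.
    by rewrite mulrAC ler_pdivrMr// mul1r.
  have -> : #|E :&: [set x | bad x]|%:R = \sum_x ((x \in E) && bad x)%:R :> R.
    rewrite -sum1_card natr_sum big_mkcond; apply: eq_bigr => x _.
    by rewrite !inE; case: (_ && _).
  apply: le_trans (ltW hw); rewrite mulr_sumr; apply: ler_sum => x _.
  rewrite /q; case: (bad x); last by rewrite andbF !mulr0.
  by rewrite andbT mulr1 lerDr sumr_ge0.
(* The good half of [E] lies in the level set of the average, which is thus large enough to be
   hit. *)
have : e (Tagged _ w) * #|X|%:R <= #|S (Tagged _ w)|%:R.
  have sub : E :\: [set x | bad x] \subset S (Tagged _ w).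
    apply/fintype.subsetP => x; rewrite !inE /= /bad -leNgt => /andP[xb xE].
    have hx : 2^-1 ^+ i.+1 <= `|h x|.
      rewrite -(@ler_sqr _ (2^-1 ^+ i.+1)) ?nnegrE ?(ltW (p2' _))//.
      rewrite real_normK ?num_real// -exprM mulnC exprM.
      by have -> : 2^-1 ^+ 2 = 4^-1 :> R by lra.
    move: xb; rewrite /delta distrC.
    have := lerB_dist (h x) (avg i w x).
    move: hx; move: (2^-1 ^+ i.+1) => z; lra.
  have /(congr1 (fun n => n%:R : R)) := cardsID [set x | bad x] E.
  rewrite natrD => cE.
  have := subset_leq_card sub; rewrite -(ler_nat R); apply: le_trans.
  suff : 2 * (e (Tagged _ w) * #|X|%:R) <= #|E|%:R by lra.
  apply: le_trans Ei; rewrite mulrA ler_pM2r// /e /=.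
  rewrite le_eqVlt; apply/orP; left; apply/eqP; field.
  by rewrite !gt_eqF.
move=> /hT[k]; rewrite inE /= => hk; exists k.
rewrite -/(h (T k)).
(* The hit point is itself a good point, so the bound passes from the average back to [h]. The
   constant 32 is then 8 * 2^2. *)
have : 2^-1 * 2^-1 ^+ i.+1 <= `|h (T k)|.
  move: (goodT k); rewrite /bad /delta -leNgt => hd.
  have := lerB_dist (avg i w (T k)) (h (T k)).
  lra.
move=> hh; apply: le_trans qi _.
rewrite [leRHS]mulrAC ler_pM2r//.
have -> : 4^-1 ^+ i.+1 = (2^-1 ^+ i.+1) ^+ 2 :> R.
  by rewrite -exprM mulnC exprM; congr (_ ^+ _); lra.
rewrite -(real_normK (num_real (h (T k)))).
by move: hh (p2' i.+1); move: (2^-1 ^+ i.+1) `|h (T k)| => z y; nra.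
Qed.

End Hitting.

(** * Characters on the grid *)

Section ComplexModulus.
Local Open Scope complex_scope.
Context {R : realType}.
Implicit Types z w : R[i].

Lemma cabsE z : (cabs z)%:C = `|z|.
Proof. by rewrite normc_def. Qed.

Lemma cabs_ge0 z : 0 <= cabs z.
Proof. exact: sqrtr_ge0. Qed.

Lemma sqr_cabs z : cabs z ^+ 2 = complex.Re z ^+ 2 + complex.Im z ^+ 2.
Proof. by rewrite sqr_sqrtr// addr_ge0 ?sqr_ge0. Qed.

Lemma cabsM z w : cabs (z * w) = cabs z * cabs w.
Proof. by apply: complexI; rewrite rmorphM /= !cabsE normrM. Qed.

Lemma cabsD z w : cabs (z + w) <= cabs z + cabs w.
Proof. by rewrite -lecR rmorphD /= !cabsE ler_normD. Qed.

Lemma cabsN z : cabs (- z) = cabs z.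
Proof. by apply: complexI; rewrite /= !cabsE normrN. Qed.

Lemma cabs0 : cabs (0 : R[i]) = 0.
Proof. by apply: complexI; rewrite cabsE normr0. Qed.

Lemma cabs_real (x : R) : cabs x%:C = `|x|.
Proof. by rewrite /cabs /= expr0n addr0 sqrtr_sqr. Qed.

Lemma cabs_sum (I : Type) (r : seq I) (P : pred I) (F : I -> R[i]) :
  cabs (\sum_(i <- r | P i) F i) <= \sum_(i <- r | P i) cabs (F i).
Proof.
elim/big_rec2: _ => [|i x z _ le]; first by rewrite cabs0.
by apply: le_trans (cabsD _ _) _; rewrite lerD2l.
Qed.

Lemma cabs_expi (t : R) : cabs (expi t) = 1.
Proof. by rewrite /cabs /= cos2Dsin2 sqrtr1. Qed.

Lemma cabs_character d (k : freq d) (x : pt R d) : cabs (character k x) = 1.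
Proof. exact: cabs_expi. Qed.

Lemma Re_le_cabs z : `|complex.Re z| <= cabs z.
Proof. by rewrite -sqrtr_sqr ler_sqrt ?lerDl ?addr_ge0 ?sqr_ge0. Qed.

Lemma Im_le_cabs z : `|complex.Im z| <= cabs z.
Proof. by rewrite -sqrtr_sqr ler_sqrt ?lerDr ?addr_ge0 ?sqr_ge0. Qed.

Lemma cabs_le_ReIm z : cabs z <= `|complex.Re z| + `|complex.Im z|.
Proof.
rewrite -(@ler_pXn2r _ 2)// ?nnegrE ?cabs_ge0 ?addr_ge0//.
rewrite sqr_cabs -(real_normK (num_real (complex.Re z))) -(real_normK (num_real (complex.Im z))).
have := normr_ge0 (complex.Re z); have := normr_ge0 (complex.Im z); nra.
Qed.

Lemma expiD (s t : R) : expi (s + t) = expi s * expi t.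
Proof. by rewrite /expi cosD sinD; simpc; congr Complex; ring. Qed.

Lemma expi0 : expi (0 : R) = 1.
Proof. by rewrite /expi cos0 sin0. Qed.

Lemma expiN (t : R) : expi (- t) = conjc (expi t).
Proof. by rewrite /expi cosN sinN. Qed.

Lemma expi_sum (I : Type) (r : seq I) (P : pred I) (F : I -> R) :
  expi (\sum_(i <- r | P i) F i) = \prod_(i <- r | P i) expi (F i).
Proof. exact: (big_morph _ expiD expi0). Qed.

Lemma expiMn (t : R) n : expi (n%:R * t) = expi t ^+ n.
Proof.
elim: n => [|n IH]; first by rewrite mul0r expi0.
by rewrite exprS -IH -expiD -natr1 mulrDl mul1r addrC.
Qed.

Lemma expi_2pi_int (k : int) : expi (2 * pi * k%:~R) = 1 :> R[i].
Proof.
have e2 : expi (2 * pi) = 1 :> R[i].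
  by rewrite /expi mulr_natl cos2pi sin2pi.
have en (n : nat) : expi (2 * pi * n%:R) = 1 :> R[i].
  by rewrite mulrC expiMn e2 expr1n.
case: k => n; first exact: en.
by rewrite NegzE mulrNz mulrN expiN en conjc1.
Qed.

Lemma expi_sin_half_neq0 (t : R) : sin (t / 2) != 0 -> expi t != 1.
Proof.
move=> s0; rewrite eq_complex /= negb_and; apply/orP; left.
have -> : t = (t / 2) *+ 2 by rewrite -mulr_natr; lra.
rewrite cos_mulr2n cos2sin2; apply/eqP => h.
move: s0; rewrite -sqrf_eq0 => /eqP; apply; lra.
Qed.

(** Cauchy-Schwarz, from the nonnegativity of the sum of squared deviations from the mean. *)
Lemma sqr_sum_le (I : finType) (S : {set I}) (a : I -> R) :
  (\sum_(i in S) a i) ^+ 2 <= #|S|%:R * \sum_(i in S) a i ^+ 2.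
Proof.
set A := \sum_(i in S) a i.
have [S0|S0] := posnP #|S|.
  by rewrite /A big_pred0 ?expr0n ?S0 ?mul0r// => i; rewrite (cards0_eq S0) inE.
have S0' : 0 < #|S|%:R :> R by rewrite ltr0n.
have : 0 <= \sum_(i in S) (a i - A / #|S|%:R) ^+ 2 by apply: sumr_ge0 => i _; exact: sqr_ge0.
have -> : \sum_(i in S) (a i - A / #|S|%:R) ^+ 2 =
    \sum_(i in S) a i ^+ 2 - A ^+ 2 / #|S|%:R.
  under eq_bigr do rewrite sqrrB.
  rewrite big_split sumrB /= sumr_const sumrMnl -mulr_suml -/A -mulr_natr.
  by field; rewrite gt_eqF.
by rewrite subr_ge0 ler_pdivrMr// mulrC.
Qed.

End ComplexModulus.

Section Grid.
Local Open Scope complex_scope.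
Context {R : realType} (d M : nat).
Local Notation Q := (2 * M).+1.

(** The group (Z/Q)^d is self-dual: the same index type names the points, through [grid_pt], and the
    frequencies in [-M, M]^d, through [grid_freq]. *)
Definition grid := {ffun 'I_d -> 'I_Q}.

Definition grid_pt (g : grid) : pt R d := [tuple (g j)%:R / Q%:R | j < d].

Definition grid_freq (u : grid) : freq d := [tuple (u j)%:Z - M%:Z | j < d].

(** Aliasing: the index of the unique frequency in the box congruent to [k] modulo Q in each
    coordinate. *)
Definition freq_class (k : freq d) : grid :=
  [ffun j => inord `|((tnth k j + M%:Z) %% Q%:Z)%Z|%N].

Definition grid_sum (c : grid -> R[i]) (g : grid) : R[i] :=
  \sum_u c u * character (grid_freq u) (grid_pt g).

Let zeta (t : int) : R[i] := expi (2 * pi * (t%:~R / Q%:R)).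

Lemma character_grid k g :
  character k (grid_pt g) = \prod_j zeta (tnth k j) ^+ (g j).
Proof.
rewrite /character /dotp mulr_sumr expi_sum; apply: eq_bigr => j _.
by rewrite tnth_mktuple -expiMn; congr expi; ring.
Qed.

Lemma zeta_mod t s : (t = s %[mod Q%:Z])%Z -> zeta t = zeta s.
Proof.
move=> ts; rewrite (divz_eq t Q%:Z) (divz_eq s Q%:Z) ts.
suff E u v : zeta (u * Q%:Z + v) = zeta v by rewrite !E.
rewrite /zeta -[RHS]mul1r -(expi_2pi_int u) -expiD; congr expi.
by rewrite rmorphD rmorphM /= -pmulrn; field.
Qed.

Lemma grid_freq_class k g :
  character (grid_freq (freq_class k)) (grid_pt g) = character k (grid_pt g).
Proof.
rewrite !character_grid; apply: eq_bigr => j _; congr (_ ^+ _).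
apply: zeta_mod; rewrite tnth_mktuple ffunE inordK.
  by rewrite gez0_abs ?modz_ge0// modzDml addrK.
have := ltz_pmod (tnth k j + M%:Z) (isT : 0 < Q%:Z).
have := modz_ge0 (tnth k j + M%:Z) (isT : Q%:Z != 0); lia.
Qed.

Lemma grid_freqK : cancel grid_freq freq_class.
Proof.
move=> u; apply/ffunP => j; rewrite ffunE tnth_mktuple subrK modz_small ?absz_nat ?inord_val//.
by rewrite lez_nat ltz_nat ltn_ord.
Qed.

Lemma freq_classK (k : freq d) :
  (forall j, `|tnth k j| <= M%:Z) -> grid_freq (freq_class k) = k.
Proof.
move=> kM; apply: eq_from_tnth => j; rewrite tnth_mktuple ffunE.
have := kM j; move: (tnth k j) => t tM.
rewrite modz_small; last by lia.
by rewrite inordK; lia.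
Qed.

(** For 0 < t < Q the half angle pi t / Q lies strictly between 0 and pi, where the sine is
    positive. Negative t follow by conjugation. *)
Lemma zeta_neq1 (t : int) : t != 0 -> `|t| < Q%:Z -> zeta t != 1.
Proof.
wlog t0 : t / 0 < t => [hw tn tQ|].
  have [|tle] := ltP 0 t; first by move=> h; apply: hw.
  have : zeta (- t) != 1.
    by apply: hw; rewrite ?normrN ?oppr_eq0// oppr_gt0 lt_neqAle tn.
  rewrite /zeta mulrNz mulNr mulrN expiN; apply: contra => /eqP ->.
  by rewrite conjc1.
move=> _; rewrite gtr0_norm// => tQ; apply: expi_sin_half_neq0.
rewrite gt_eqF//; apply: sin_gt0_pi.
have -> : 2 * pi * (t%:~R / Q%:R) / 2 = pi * (t%:~R / Q%:R) :> R.
  by move: (t%:~R / Q%:R) => y; field.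
have Qp : 0 < Q%:R :> R by rewrite ltr0n.
rewrite mulr_gt0 ?pi_gt0 ?divr_gt0 ?ltr0z//=.
by rewrite -[ltRHS]mulr1 ltr_pM2l ?pi_gt0// ltr_pdivrMr// mul1r pmulrn ltr_int.
Qed.

(** The sum factors over the coordinates into geometric sums of Q-th roots of unity; in a coordinate
    where [u] and [v] differ the root is not 1 and its geometric sum vanishes. *)
Lemma grid_orthogonal u v :
  \sum_g character (grid_freq u) (grid_pt g) *
         conjc (character (grid_freq v) (grid_pt g)) = ((u == v) * Q ^ d)%:R.
Proof.
have E g : character (grid_freq u) (grid_pt g) * conjc (character (grid_freq v) (grid_pt g))
    = \prod_j zeta ((u j)%:Z - (v j)%:Z) ^+ (g j).
  rewrite [X in _ * conjc X]/character -expiN -expiD.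
  transitivity (character [tuple (u j)%:Z - (v j)%:Z | j < d] (grid_pt g)).
    rewrite /character; congr expi; rewrite -mulrBr; congr (_ * _).
    rewrite /dotp -sumrB; apply: eq_bigr => j _.
    by rewrite !tnth_mktuple -mulrBl -rmorphB /=; congr (_%:~R * _); ring.
  by rewrite character_grid; apply: eq_bigr => j _; rewrite tnth_mktuple.
under eq_bigr do rewrite E.
rewrite -(bigA_distr_bigA (fun j (a : 'I_Q) => zeta ((u j)%:Z - (v j)%:Z) ^+ a)).
case: eqVneq => [->|uv].
  rewrite mul1n natrX -[d in RHS]card_ord -prodr_const; apply: eq_bigr => j _.
  rewrite subrr /zeta mul0r mulr0 expi0.
  by under eq_bigr do rewrite expr1n; rewrite sumr_const card_ord.
have [j uvj] : exists j, u j != v j.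
  apply/existsP; rewrite -negb_forall; apply: contra uv => /forallP h.
  by apply/eqP/ffunP => j; apply/eqP.
rewrite mul0n (bigD1 j)//=; set z := zeta _.
have z1 : z != 1.
  apply: zeta_neq1.
    by rewrite subr_eq0; apply: contra uvj => /eqP [] /val_inj ->.
  by have := ltn_ord (u j); have := ltn_ord (v j); lia.
have zQ : z ^+ Q = 1.
  rewrite /z /zeta -expiMn -[RHS](expi_2pi_int ((u j)%:Z - (v j)%:Z)).
  by congr expi; field.
have /eqP := subrX1 z Q; rewrite zQ subrr eq_sym mulf_eq0 subr_eq0 (negbTE z1) /=.
by move=> /eqP ->; rewrite mul0r.
Qed.

Lemma grid_coefficient c v :
  \sum_g grid_sum c g * conjc (character (grid_freq v) (grid_pt g)) =
  (Q ^ d)%:R * c v.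
Proof.
rewrite /grid_sum; under eq_bigr do rewrite mulr_suml.
rewrite exchange_big /= (bigD1 v)//= [X in _ + X]big1 ?addr0.
  by under eq_bigr do rewrite -mulrA; rewrite -mulr_sumr grid_orthogonal eqxx mul1n mulrC.
move=> u /negbTE uv; under eq_bigr do rewrite -mulrA.
by rewrite -mulr_sumr grid_orthogonal uv mul0n mulr0.
Qed.

Lemma grid_parseval c :
  \sum_g cabs (grid_sum c g) ^+ 2 = (Q ^ d)%:R * \sum_u cabs (c u) ^+ 2.
Proof.
apply: complexI; rewrite rmorphM /= !rmorph_sum /= rmorph_nat.
under eq_bigr do rewrite rmorphXn /= cabsE sqr_normc.
under [in RHS]eq_bigr do rewrite rmorphXn /= cabsE sqr_normc.
under eq_bigr do rewrite {2}/grid_sum rmorph_sum mulr_sumr.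
rewrite exchange_big /= mulr_sumr; apply: eq_bigr => u _.
under eq_bigr do rewrite rmorphM /= mulrCA.
by rewrite -mulr_sumr grid_coefficient; ring.
Qed.

Lemma card_grid : #|grid| = (Q ^ d)%N.
Proof. by rewrite card_ffun !card_ord. Qed.

End Grid.

(** * Sparse grid polynomials as convex combinations of signed characters *)

Section RealDictionary.
Local Open Scope complex_scope.
Context {R : realType}.

(* Complex functions on the grid are handled as real functions on grid * bool,
   the boolean selecting the real or the imaginary part.  A coefficient z is the
   nonnegative combination [weight z] of the four units [direction]. *)
Definition part (b : bool) (z : R[i]) : R := if b then complex.Im z else complex.Re z.

Definition direction (bs : bool * bool) : R[i] :=
  (-1) ^+ bs.2 * (if bs.1 then 'i else 1).

Definition weight (z : R[i]) (bs : bool * bool) : R :=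
  (`|part bs.1 z| + (-1) ^+ bs.2 * part bs.1 z) / 2.

(** The total weight of [z] over the four directions, see [sum_weight]; dividing by its sum over all
    coefficients makes a grid polynomial a convex combination. *)
Definition cabs1 (z : R[i]) : R := `|complex.Re z| + `|complex.Im z|.

Lemma part_sum b (I : Type) (r : seq I) (P : pred I) (F : I -> R[i]) :
  part b (\sum_(i <- r | P i) F i) = \sum_(i <- r | P i) part b (F i).
Proof.
by apply: (big_morph (part b)) => [[? ?] [? ?]|]; case: b.
Qed.

Lemma part_scale b (a : R) z : part b (a%:C * z) = a * part b z.
Proof. by case: z => x y; case: b; rewrite /part /= !mul0r ?subr0 ?addr0. Qed.

Lemma part_le_cabs b z : `|part b z| <= cabs z.
Proof. by case: b; [exact: Im_le_cabs|exact: Re_le_cabs]. Qed.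

Lemma sqr_cabs_part z : cabs z ^+ 2 = \sum_b part b z ^+ 2.
Proof. by rewrite big_bool sqr_cabs addrC. Qed.

Lemma cabs1_ge0 z : 0 <= cabs1 z.
Proof. by rewrite addr_ge0. Qed.

Lemma sqr_cabs1_le z : cabs1 z ^+ 2 <= 2 * cabs z ^+ 2.
Proof.
rewrite sqr_cabs -(real_normK (num_real (complex.Re z))) -(real_normK (num_real (complex.Im z))).
rewrite /cabs1; move: `|_| `|_| => x y; have := sqr_ge0 (x - y); nra.
Qed.

Lemma cabs1_le z : cabs1 z <= 2 * cabs z.
Proof. by have := Re_le_cabs z; have := Im_le_cabs z; rewrite /cabs1; lra. Qed.

Lemma cabs_direction bs : cabs (direction bs) = 1.
Proof.
case: bs => b s; rewrite /direction /= cabsM.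
have -> : cabs ((-1) ^+ s : R[i]) = 1.
  by apply: complexI; rewrite cabsE normrX normrN1 expr1n.
by case: b; rewrite mul1r /cabs /= ?expr0n ?expr1n ?add0r ?addr0 sqrtr1.
Qed.

Lemma weight_ge0 z bs : 0 <= weight z bs.
Proof.
rewrite divr_ge0//; case: bs => b s /=; move: (part b z) => x.
by case: s; rewrite ?expr0 ?expr1 ?mulN1r ?mul1r -lerBlDr sub0r ?opprK ?ler_norm// -normrN ler_norm.
Qed.

Lemma sum_weight z : \sum_bs weight z bs = cabs1 z.
Proof.
rewrite -(pair_bigA _ (fun b s => weight z (b, s))) /= !big_bool /weight /= /cabs1.
by rewrite expr0 expr1; lra.
Qed.

Lemma sum_weight_direction z : \sum_bs (weight z bs)%:C * direction bs = z.
Proof.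
rewrite -(pair_bigA _ (fun b s => (weight z (b, s))%:C * direction (b, s))) /=.
rewrite !big_bool /weight /direction /= expr0 expr1; case: z => x y; simpc.
  by congr Complex => /=; field.
Qed.

Lemma part_decomposition (U : finType) (c e : U -> R[i]) b :
  part b (\sum_u c u * e u) =
  \sum_(i : U * (bool * bool)) weight (c i.1) i.2 * part b (direction i.2 * e i.1).
Proof.
rewrite -(pair_bigA _ (fun u bs => weight (c u) bs * part b (direction bs * e u))) /=.
rewrite part_sum; apply: eq_bigr => u _.
rewrite -{1}(sum_weight_direction (c u)) mulr_suml part_sum.
by apply: eq_bigr => bs _; rewrite -mulrA part_scale.
Qed.

Lemma sum_cabs1_eq0 (U : finType) (c : U -> R[i]) :
  \sum_u cabs1 (c u) = 0 -> forall u, c u = 0.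
Proof.
move=> /eqP; rewrite psumr_eq0; last by move=> ? _; exact: cabs1_ge0.
move=> /allP h u; have /= /eqP := h u (mem_index_enum _).
case: (c u) => x y; rewrite /cabs1 /= => xy.
have := normr_ge0 x; have := normr_ge0 y => hy hx.
by congr Complex; apply/eqP; rewrite -normr_eq0; apply/eqP; lra.
Qed.

Definition dictionary d M (i : grid d M * (bool * bool)) (x : grid d M * bool) : R :=
  part x.2 (direction i.2 * character (grid_freq i.1) (grid_pt x.1)).

Lemma dictionary_le1 d M (i : grid d M * (bool * bool)) x : `|dictionary i x| <= 1.
Proof.
by rewrite (le_trans (part_le_cabs _ _))// cabsM cabs_direction cabs_character mulr1.
Qed.

Lemma grid_sum_convex d M (c : grid d M -> R[i]) : 0 < \sum_u cabs1 (c u) ->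
  exists p : grid d M * (bool * bool) -> R,
    [/\ forall i, 0 <= p i, \sum_i p i = 1 &
     forall x, \sum_i p i * dictionary i x =
               part x.2 (grid_sum c x.1) / \sum_u cabs1 (c u)].
Proof.
set A := \sum_u cabs1 (c u) => A0; exists (fun i => weight (c i.1) i.2 / A); split.
- by move=> i; rewrite divr_ge0 ?weight_ge0// ltW.
- rewrite -mulr_suml -(pair_bigA _ (fun u bs => weight (c u) bs)) /=.
  by under eq_bigr do rewrite sum_weight; rewrite divff// gt_eqF.
move=> x; rewrite /grid_sum part_decomposition mulr_suml; apply: eq_bigr => i _.
by rewrite mulrAC.
Qed.

(** Sparsity enters through Cauchy-Schwarz and Parseval: after normalising the l1 norm [A] to 1, the
    mean square cannot be too small, which is the hypothesis of [exists_hitting_points]. A hit in a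
    real or imaginary part bounds the modulus at that grid point, so the boolean is dropped. The
    constant is 64 = 32 * 2, as there are two parts per grid point. *)
Lemma exists_grid_points (d M J m l b n : nat) :
  (0 < J)%N -> (4 * (2 * M).+1 ^ d <= 2 ^ b)%N -> (2 * (m + 2) < 2 ^ l)%N ->
  (8 * J * 4 ^ J * (512 * l * b + 1) <= m)%N -> (8 * n <= 4 ^ J)%N ->
  exists T : {ffun 'I_m -> grid d M}, forall (c : grid d M -> R[i]) (eta : R),
    (#|[set u | c u != 0%R]| <= n)%N -> (forall k, cabs (grid_sum c (T k)) <= eta) ->
    \sum_g cabs (grid_sum c g) ^+ 2 <= 64 * ((2 * M).+1 ^ d)%:R * eta ^+ 2.
Proof.
move=> J0 hb hl hm hn; set N := ((2 * M).+1 ^ d)%N in hb *.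
have N0 : (0 < N)%N by rewrite expn_gt0.
have N0' : 0 < N%:R :> R by rewrite ltr0n.
pose X := (grid d M * bool)%type.
pose I := (grid d M * (bool * bool))%type.
have cX : #|{: X}| = (N * 2)%N by rewrite card_prod card_grid card_bool.
have X0 : (0 < #|{: X}|)%N by rewrite cX muln_gt0 N0.
have cI : (#|{: I}| <= 2 ^ b)%N by rewrite !card_prod card_grid card_bool mulnC.
have [T hT] := exists_hitting_points X0 J0 (@dictionary_le1 d M) cI hl hm.
have m0 : (0 < m)%N.
  by apply: leq_trans hm; rewrite !muln_gt0 J0 expn_gt0 addn1.
exists [ffun k => (T k).1] => c eta cn hc.
have eta0 : 0 <= eta by rewrite (le_trans (cabs_ge0 _) (hc (Ordinal m0))).
pose A := \sum_u cabs1 (c u).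
have [/sum_cabs1_eq0 c0|A0] := eqVneq A 0.
  rewrite big1 ?mulr_ge0 ?sqr_ge0// => g _.
  by rewrite /grid_sum big1 ?cabs0 ?expr0n// => u _; rewrite c0 mul0r.
have {A0} Ap : 0 < A by rewrite lt_neqAle eq_sym A0 sumr_ge0// => ? _; exact: cabs1_ge0.
have [p [p0 p1 hE]] := grid_sum_convex Ap; rewrite -/A in hE.
have sumE : \sum_x (\sum_i p i * dictionary i x) ^+ 2 =
    (\sum_g cabs (grid_sum c g) ^+ 2) / A ^+ 2.
  under eq_bigr do rewrite hE expr_div_n.
  rewrite -mulr_suml -(pair_bigA _ (fun g b => part b (grid_sum c g) ^+ 2)) /=.
  by congr (_ / _); apply: eq_bigr => g _; rewrite sqr_cabs_part.
have A2 : A ^+ 2 <= 2 * n%:R * \sum_u cabs (c u) ^+ 2.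
  pose S := [set u | c u != 0].
  have -> : A = \sum_(u in S) cabs1 (c u).
    rewrite [RHS]big_mkcond; apply: eq_bigr => u _; rewrite inE.
    by case: eqVneq => // ->; rewrite /cabs1 /= normr0 addr0.
  apply: le_trans (sqr_sum_le _ _) _.
  apply: (@le_trans _ _ (#|S|%:R * (2 * \sum_u cabs (c u) ^+ 2))).
    rewrite ler_wpM2l// mulr_sumr big_mkcond; apply: ler_sum => u _.
    by case: ifP => _; rewrite ?sqr_cabs1_le// mulr_ge0 ?sqr_ge0.
  rewrite mulrCA mulrA ler_wpM2r ?sumr_ge0// => [u _|]; first exact: sqr_ge0.
  by rewrite ler_wpM2l// ler_nat.
(* By [A2] the normalised sum of squares is at least N / (2n), while 4 N / 4^J is required; this is
   the condition [8 * n <= 4 ^ J]. *)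
have large : 2 * 4^-1 ^+ J * #|{: X}|%:R <= \sum_x (\sum_i p i * dictionary i x) ^+ 2.
  rewrite sumE ler_pdivlMr ?exprn_gt0// grid_parseval -/N cX natrM.
  have P0 : 0 <= \sum_u cabs (c u) ^+ 2 by apply: sumr_ge0 => u _; exact: sqr_ge0.
  apply: (@le_trans _ _ (4^-1 ^+ J * (8 * n%:R) * N%:R * \sum_u cabs (c u) ^+ 2)).
    have : 0 <= 4^-1 ^+ J * N%:R :> R by rewrite mulr_ge0// exprn_ge0.
    move: A2; move: (4^-1 ^+ J) (\sum_u _) => z P h hz.
    have := ler_wpM2l hz h; lra.
  rewrite ler_wpM2r// ler_piMl// exprVn mulrC ler_pdivrMr ?exprn_gt0// mul1r.
  by rewrite -natrX -natrM ler_nat.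
have [k] := hT p p0 p1 large.
rewrite sumE ler_pdivrMr ?exprn_gt0// => /le_trans; apply.
rewrite hE expr_div_n -!mulrA mulVf ?mulr1 ?gt_eqF ?exprn_gt0// cX natrM.
have hk : part (T k).2 (grid_sum c (T k).1) ^+ 2 <= eta ^+ 2.
  rewrite -real_normK ?num_real// lerXn2r ?nnegrE//.
  by apply: le_trans (part_le_cabs _ _) _; have := hc k; rewrite ffunE.
have := ler_wpM2l (ltW N0') hk; lra.
Qed.

End RealDictionary.

(** * Fourier coefficients with respect to Haar measure *)

Section HaarIntegral.
Local Open Scope classical_set_scope.
Context {R : realType}.
Local Notation mu := (@lebesgue_measure R).

Lemma continuous_cos_affine (a b t : R) : continuous (fun y : R => 1 + b * cos (a * y + t)).
Proof.
move=> y; apply/differentiable_continuous/derivable1_diffP.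
have dl : is_derive y (1 : R) (fun y => cos (a * y + t)) (- sin (a * y + t) * a).
  apply: (is_derive1_comp (is_derive_cos _)).
  by apply: is_derive_eq; rewrite addr0 /GRing.scale /= mulr1.
by apply: ex_derive.
Qed.

Lemma integral_unit_interval_cos (a b t : R) : a != 0 ->
  (\int[mu]_(y in `[0%R, 1%R]) (1 + b * cos (a * y + t))%:E =
   (1 + b * (sin (a + t) - sin t) / a)%:E)%E.
Proof.
move=> a0; pose F (y : R) : R := y + b / a * sin (a * y + t).
have dF (y : R) : is_derive y (1 : R) F (1 + b * cos (a * y + t)).
  have dl : is_derive y (1 : R) (fun y => a * y + t) a.
    by apply: is_derive_eq; rewrite addr0 /GRing.scale /= mulr1.
  have ds : is_derive y (1 : R) (fun y => sin (a * y + t)) (a * cos (a * y + t)).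
    apply: is_derive_eq (is_derive1_comp (is_derive_sin _) dl) _.
    by rewrite mulrC.
  by apply: is_derive_eq; rewrite /GRing.scale /=; field.
have cF (y : R) : {for y, continuous F}.
  by apply/differentiable_continuous/derivable1_diffP; exact: ex_derive.
rewrite (@continuous_FTC2 _ _ F)//.
- by rewrite -EFinB /F; congr (_%:E); rewrite !mulr1 mulr0 !add0r; field.
- by apply: continuous_subspaceT => y; exact: continuous_cos_affine.
- split.
  + by move=> y _; exact: ex_derive.
  + by apply: cvg_at_right_filter; exact: cF.
  + by apply: cvg_at_left_filter; exact: cF.
- by move=> y _; rewrite derive1E; exact: derive_val.
Qed.

Lemma measurable_dotp d (k : freq d) :
  measurable_fun [set: pt R d] (@dotp R d k).
Proof.
apply: measurable_sum => j; apply: measurable_funM => //.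
exact: measurable_tnth.
Qed.

Lemma measurable_cos_dotp d (k : freq d) (a t : R) :
  measurable_fun [set: pt R d] (fun x => cos (a * dotp k x + t)).
Proof.
apply: (@measurableT_comp _ _ _ _ _ _ (@cos R)).
  by apply: continuous_measurable_fun; exact: continuous_cos.
apply: measurable_funD => //; apply: measurable_funM => //.
exact: measurable_dotp.
Qed.

Lemma dotp_cons d (k : freq d.+1) (y : measurableTypeR R) (x : pt R d) :
  dotp k (cons_pt (y, x)) = (thead k)%:~R * y + dotp (behead_tuple k) x.
Proof.
rewrite /dotp big_ord_recl; congr (_ + _).
apply: eq_bigr => j _; rewrite tnthS; congr (_%:~R * _).
by rewrite tnth_behead; congr (tnth k _); apply: val_inj; rewrite /= inordK ?ltnS ?ltn_ord.
Qed.

Definition zero_freq d (k : freq d) := [forall j, tnth k j == 0].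

Lemma zero_freq_cons d (k : freq d.+1) :
  zero_freq k = (thead k == 0) && zero_freq (behead_tuple k).
Proof.
apply/forallP/andP => [k0|[k0 /forallP kS] j].
  split; first exact: k0.
  by apply/forallP => j; have := k0 (lift ord0 j); rewrite [in tnth k _](tuple_eta k) tnthS.
case: (unliftP ord0 j) => [i ->|->]; last exact: k0.
by rewrite [in tnth k _](tuple_eta k) tnthS; exact: kS.
Qed.

Lemma sinD2piz (k : int) (t : R) : sin (2 * pi * k%:~R + t) = sin t.
Proof.
have := congr1 (@complex.Im R) (expiD (2 * pi * k%:~R) t).
by rewrite expi_2pi_int mul1r.
Qed.

Lemma ge0_integral_haarS d (f : pt R d.+1 -> \bar R) :
  measurable_fun [set: pt R d.+1] f -> (forall x, 0 <= f x)%E ->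
  (\int[haar R d.+1]_x f x =
   \int[uniform_prob (@ltr01 R)]_y \int[haar R d]_x f (cons_pt (y, x)))%E.
Proof.
move=> mf f0; transitivity
    (\int[(uniform_prob (@ltr01 R) \x haar R d)%E]_z (f \o @cons_pt R d) z)%E.
  exact: ge0_integral_distribution.
rewrite fubini_tonelli1//; last by move=> x; exact: f0.
exact: (@measurableT_comp _ _ _ _ _ _ f _ (@cons_pt R d) mf (@measurable_cons_pt R d)).
Qed.

(* Adding 1 makes the integrand nonnegative, so that Tonelli's theorem and the
   transfer lemmas for nonnegative functions apply. *)
Lemma integral_one_plus_cos d (k : freq d) (t : R) :
  (\int[haar R d]_x (1 + cos (2 * pi * dotp k x + t))%:E =
   (1 + (zero_freq k)%:R * cos t)%:E)%E.
Proof.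
have mcos d' (k' : freq d') t' : measurable_fun [set: pt R d']
    (EFin \o (fun x => 1 + cos (2 * pi * dotp k' x + t'))).
  by apply/measurable_EFinP; apply: measurable_funD => //; exact: measurable_cos_dotp.
have pos t' : 0 <= 1 + cos t' :> R by have := cos_geN1 t'; lra.
elim: d k t => [|d IH] k t.
  rewrite integral_dirac //=; last exact: mcos.
  rewrite diracT mul1e /dotp big_ord0 mulr0 add0r.
  have -> : zero_freq k by apply/forallP => -[].
  by rewrite mul1r.
rewrite ge0_integral_haarS; [|exact: mcos|by move=> x; rewrite lee_fin].
under eq_integral => y _.
  under eq_integral => x _.
    rewrite dotp_cons mulrDr [_ + _ + t]addrAC [_ + t + _]addrC mulrA.
    over.
  rewrite IH.
  over.
(* By induction the inner integral is 1 + b cos(a y + t). If the first frequency is 0 this is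
   constant in y; otherwise y runs through whole periods and the cosine integrates to 0. *)
pose b : R := (zero_freq (behead_tuple k))%:R.
rewrite integral_uniform; last 2 first.
- apply/measurable_EFinP; apply: continuous_measurable_fun.
  exact: continuous_cos_affine.
- move=> y; rewrite lee_fin; case: zero_freq; rewrite ?mul1r ?mul0r ?addr0//.
rewrite subr0 invr1 mul1e zero_freq_cons -/b.
have [k0|k0] := eqVneq (thead k) 0.
  under eq_integral do rewrite k0 mulr0z mulr0 mul0r add0r.
  rewrite integral_cst//= lebesgue_measure_itv/= lte01.
  by rewrite oppr0 adde0 mule1.
rewrite (integral_unit_interval_cos _ _) /= ?sinD2piz ?subrr ?mulr0 ?mul0r//.
by rewrite !mulf_neq0 ?intr_eq0 ?pnatr_eq0// gt_eqF ?pi_gt0.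
Qed.

End HaarIntegral.

Section HaarMean.
Local Open Scope classical_set_scope.
Local Open Scope complex_scope.
Context {R : realType} (d : nat).
Implicit Types (f g : pt R d -> R) (k : freq d).

(** Integrability and value are bundled so that the linearity rules carry both at once. *)
Definition haar_mean f (a : R) :=
  (haar R d).-integrable [set: pt R d] (EFin \o f) /\ (\int[haar R d]_x f x)%R = a.

Lemma haar_meanD f g a b : haar_mean f a -> haar_mean g b ->
  haar_mean (fun x => f x + g x) (a + b).
Proof.
move=> [If <-] [Ig <-]; split; last exact: RintegralD.
by have := integrableD measurableT If Ig.
Qed.

Lemma haar_meanZ f c a : haar_mean f a -> haar_mean (fun x => c * f x) (c * a).
Proof.
move=> [If <-]; split; last exact: RintegralZl.
by have := integrableZl measurableT c If.
Qed.

Lemma haar_mean_cst c : haar_mean (fun=> c) c.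
Proof.
split; last by rewrite Rintegral_cst//= probability_setT mulr1.
exact: finite_measure_integrable_cst.
Qed.

Lemma haar_mean_sum (I : Type) (s : seq I) (F : I -> pt R d -> R) (a : I -> R) :
  (forall i, haar_mean (F i) (a i)) ->
  haar_mean (fun x => \sum_(i <- s) F i x) (\sum_(i <- s) a i).
Proof.
move=> h; elim: s => [|i s IH].
  rewrite big_nil; under eq_fun do rewrite big_nil; exact: haar_mean_cst.
by rewrite big_cons; under eq_fun do rewrite big_cons; exact: haar_meanD.
Qed.

Lemma haar_mean_cos k t :
  haar_mean (fun x => cos (2 * pi * dotp k x + t)) ((zero_freq k)%:R * cos t).
Proof.
have I1 : (haar R d).-integrable [set: pt R d]
    (EFin \o (fun x => 1 + cos (2 * pi * dotp k x + t))).
  apply/integrableP; split.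
    apply/measurable_EFinP; apply: measurable_funD => //; exact: measurable_cos_dotp.
  rewrite (eq_integral (fun x => (1 + cos (2 * pi * dotp k x + t))%:E)).
    by rewrite integral_one_plus_cos ltry.
  move=> x _; have p : 0 <= 1 + cos (2 * pi * dotp k x + t).
    by have := cos_geN1 (2 * pi * dotp k x + t); lra.
  by rewrite /= ger0_norm.
have H1 : haar_mean (fun x => 1 + cos (2 * pi * dotp k x + t)) (1 + (zero_freq k)%:R * cos t).
  by split => //; rewrite /Rintegral integral_one_plus_cos.
have := haar_meanD (haar_mean_cst (- 1)) H1.
by under eq_fun do rewrite addKr; rewrite addKr.
Qed.

(** The sine is a cosine shifted by pi / 2, which is why [haar_mean_cos] carries a phase. *)
Lemma haar_mean_character b (z : R[i]) k :
  haar_mean (fun x => part b (z * character k x))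
    (part b (if zero_freq k then z else 0)).
Proof.
have hc : haar_mean (fun x => cos (2 * pi * dotp k x)) (zero_freq k)%:R.
  have := haar_mean_cos k 0; rewrite cos0 mulr1.
  by under eq_fun do rewrite addr0.
have hs : haar_mean (fun x => sin (2 * pi * dotp k x)) 0.
  have := haar_mean_cos k (- (pi / 2)); rewrite cosN cos_pihalf mulr0.
  by under eq_fun do rewrite cosBpihalf.
case: z => u v; case: b; rewrite /part /character /expi /=.
  have -> : complex.Im (if zero_freq k then u +i* v else 0) = u * 0 + v * (zero_freq k)%:R.
    by case: zero_freq => /=; rewrite ?mulr0 ?add0r ?mulr1.
  by apply: haar_meanD; exact: haar_meanZ.
have -> : complex.Re (if zero_freq k then u +i* v else 0) = u * (zero_freq k)%:R + (- v) * 0.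
  by case: zero_freq => /=; rewrite ?mulr0 ?addr0 ?mulr1.
under eq_fun do rewrite -mulNr.
by apply: haar_meanD; exact: haar_meanZ.
Qed.

Definition freq_sub (k l : freq d) : freq d := [tuple tnth k j - tnth l j | j < d].

Lemma zero_freq_sub k l : zero_freq (freq_sub k l) = (k == l).
Proof.
apply/forallP/eqP => [h|-> j]; last by rewrite tnth_mktuple subrr.
by apply: eq_from_tnth => j; have := h j; rewrite tnth_mktuple subr_eq0 => /eqP.
Qed.

Lemma character_sub k l (x : pt R d) :
  character (freq_sub k l) x = character k x * expi (- (2 * pi * dotp l x)).
Proof.
rewrite -expiD /character; congr expi; rewrite -mulrBr; congr (_ * _).
rewrite /dotp -sumrB; apply: eq_bigr => j _.
by rewrite tnth_mktuple rmorphB mulrBl.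
Qed.

Lemma cintegralE (f : pt R d -> R[i]) (w : R[i]) :
  (forall b, haar_mean (fun x => part b (f x)) (part b w)) ->
  cintegrable f /\ cintegral f = w.
Proof.
move=> h; have [I0 E0] := h false; have [I1 E1] := h true; split; first by split.
by rewrite /cintegral [X in Complex X _]E0 [X in Complex _ X]E1; case: w {h E0 E1}.
Qed.

Lemma cintegrable_trig_sum (c : freq d -> R[i]) (J : {fset freq d}) :
  cintegrable (trig_sum c J).
Proof.
suff /cintegralE[] : forall b, haar_mean (fun x => part b (trig_sum c J x))
  (part b (\sum_(k <- J) (if zero_freq k then c k else 0))) by [].
move=> b; rewrite part_sum; rewrite /trig_sum.
under eq_fun do rewrite part_sum.
by apply: haar_mean_sum => k; exact: haar_mean_character.
Qed.

Lemma fourier_trig_sum (c : freq d -> R[i]) (J : {fset freq d}) l :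
  fourier (trig_sum c J) l = if l \in J then c l else 0.
Proof.
rewrite /fourier.
have [] := @cintegralE (fun x => trig_sum c J x * expi (- (2 * pi * dotp l x)))
  (\sum_(k <- J) (if zero_freq (freq_sub k l) then c k else 0)).
  move=> b; rewrite part_sum /trig_sum.
  under eq_fun do rewrite mulr_suml part_sum.
  apply: haar_mean_sum => k.
  under eq_fun do rewrite -mulrA -character_sub.
  exact: haar_mean_character.
move=> _ ->; under eq_bigr do rewrite zero_freq_sub.
have [lJ|lJ] := boolP (l \in J).
  rewrite (big_fsetD1 l)//= eqxx big_seq big1 ?addr0// => k.
  by rewrite !inE => /andP[/negbTE ->].
by rewrite big_seq big1// => k kJ; case: eqP => // kl; rewrite -kl kJ in lJ.
Qed.

(** Expanding the square gives characters at the differences of the frequencies; as [fr] is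
    injective, only the diagonal terms have nonzero mean. *)
Lemma haar_mean_parseval (U : finType) (fr : U -> freq d) (c : U -> R[i]) :
  injective fr ->
  haar_mean (fun x => cabs (\sum_u c u * character (fr u) x) ^+ 2)
    (\sum_u cabs (c u) ^+ 2).
Proof.
move=> inj_fr.
have E x : cabs (\sum_u c u * character (fr u) x) ^+ 2 =
    \sum_u \sum_v part false (c u * conjc (c v) * character (freq_sub (fr u) (fr v)) x).
  have -> (z : R[i]) : cabs z ^+ 2 = part false (z * conjc z).
    by rewrite sqr_cabs; case: z => a b; rewrite /part /= mulrN opprK !expr2.
  rewrite mulr_suml part_sum; apply: eq_bigr => u _.
  rewrite rmorph_sum mulr_sumr part_sum; apply: eq_bigr => v _.
  by rewrite rmorphM character_sub expiN mulrACA.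
under eq_fun do rewrite E.
have -> : \sum_u cabs (c u) ^+ 2 = \sum_u \sum_v part false
    (if zero_freq (freq_sub (fr u) (fr v)) then c u * conjc (c v) else 0).
  apply: eq_bigr => u _; rewrite (bigD1 u)//= zero_freq_sub eqxx big1 ?addr0.
    by rewrite sqr_cabs; case: (c u) => a b; rewrite /part /= mulrN opprK !expr2.
  by move=> v vu; rewrite zero_freq_sub (inj_eq inj_fr) eq_sym (negbTE vu).
apply: haar_mean_sum => u; apply: haar_mean_sum => v.
exact: haar_mean_character.
Qed.

End HaarMean.

(** * Reduction of sampling numbers to grid points *)

Section WienerBall.
Local Open Scope classical_set_scope.
Local Open Scope complex_scope.
Context {R : realType} (r : R) (d : nat).
Hypothesis r0 : 0 <= r.
Implicit Types (f g : pt R d -> R[i]) (k : freq d).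

Definition freq_weight k : R := \prod_(j < d) (1 + `|(tnth k j)%:~R|) `^ r.

Lemma freq_weight_ge1 k : 1 <= freq_weight k.
Proof.
rewrite /freq_weight; elim/big_ind: _ => [//|x y|j _]; first exact: mulr_ege1.
by rewrite -[leLHS](powRr0 (1 + `|(tnth k j)%:~R| : R)) ler_powR ?lerDl.
Qed.

Lemma freq_weight_ge k j : (1 + `|(tnth k j)%:~R|) `^ r <= freq_weight k.
Proof.
rewrite /freq_weight (bigD1 j)//= ler_peMr ?powR_ge0//.
elim/big_ind: _ => [//|x y|i _]; first exact: mulr_ege1.
by rewrite -[leLHS](powRr0 (1 + `|(tnth k i)%:~R| : R)) ler_powR ?lerDl.
Qed.

Lemma wiener_ball_sum f (J : {fset freq d}) : wiener_ball r d f ->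
  \sum_(k <- J) cabs (fourier f k) * freq_weight k <= 1.
Proof.
move=> [_ /= f1]; rewrite -lee_fin; apply: le_trans f1.
apply: esum_ge; exists [set` J]; first by split.
by rewrite -sumEFin fsbig_seq.
Qed.

(** The value f(x) is the limit of its partial sums along finite sets. A close partial sum may be
    taken over a set containing [B]; what it has beyond [B] carries weights at least [W] and hence
    has l1 norm at most 1 / W. *)
Lemma wiener_ball_tail f (B : {fset freq d}) (W : R) x : wiener_ball r d f ->
  0 < W -> (forall k, k \notin B -> W <= freq_weight k) ->
  cabs (f x - trig_sum (fourier f) B x) <= W^-1.
Proof.
move=> bf W0 hW; have [[_ _ _ /(_ x) fx] _] := bf.
apply/ler_addgt0Pr => e e0.
have e0' : 0 < e%:C by rewrite ltcR.
have FF : Filter (@totally (freq d)) by case: (@totally_filter (freq d)).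
have : \forall J \near @totally (freq d), `|f x - trig_sum (fourier f) J x| < e%:C.
  exact: (@cvgr_dist_lt R[i] R[i]^o _ _ FF (fun J => trig_sum (fourier f) J x) (f x) fx _ e0').
move=> [A _ hA].
pose J := (A `|` B)%fset.
have /= := hA J (fsubsetUl _ _); rewrite -cabsE ltcR => hJ.
rewrite -(subrKA (trig_sum (fourier f) J x)) addrC.
apply: le_trans (cabsD _ _) _; rewrite lerD//; last exact: ltW.
have -> : trig_sum (fourier f) J x - trig_sum (fourier f) B x =
    trig_sum (fourier f) (J `\` B)%fset x.
  rewrite /trig_sum (big_fsetID _ (mem B))/= addrAC.
  have -> : [fset k in J | k \in B]%fset = B.
    by apply/fsetP => k; rewrite !inE; case: (k \in B); rewrite ?orbT ?andbF.
  have -> : [fset k in J | k \notin B]%fset = (J `\` B)%fset.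
    by apply/fsetP => k; rewrite !inE andbC.
  by rewrite subrr add0r.
apply: le_trans (cabs_sum _ _ _) _.
rewrite -[leRHS]mulr1.
apply: le_trans (ler_wpM2l _ (wiener_ball_sum (J `\` B)%fset bf)); last first.
  by rewrite invr_ge0 ltW.
rewrite mulr_sumr big_seq [leRHS]big_seq; apply: ler_sum => k.
rewrite !inE => /andP[kB _]; rewrite cabsM cabs_character mulr1.
by rewrite mulrCA ler_peMr ?cabs_ge0// mulrC ler_pdivlMr// mul1r hW.
Qed.

Lemma wiener_ball_bounded f x : wiener_ball r d f -> cabs (f x) <= 1.
Proof.
move=> bf; have := @wiener_ball_tail f fset0 1 x bf ltr01.
rewrite /trig_sum big_seq_fset0 subr0 invr1; apply => k _.
exact: freq_weight_ge1.
Qed.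

(** Outside the box some coordinate exceeds M in modulus, and this one factor already makes the
    weight at least M^r. *)
Lemma wiener_ball_box f (M : nat) x : (0 < M)%N -> wiener_ball r d f ->
  cabs (f x - \sum_(u : grid d M) fourier f (grid_freq u) * character (grid_freq u) x)
  <= M%:R `^ (- r).
Proof.
move=> M0 bf; pose B := [fset @grid_freq d M u | u : grid d M]%fset.
rewrite powRN; have -> : \sum_(u : grid d M) fourier f (grid_freq u) * character (grid_freq u) x
   = trig_sum (fourier f) B x.
  rewrite /trig_sum big_imfset/=; last by move=> u v _ _; exact: (can_inj (@grid_freqK d M)).
  by rewrite big_enum.
apply: wiener_ball_tail => //; first by rewrite powR_gt0// ltr0n.
move=> k kB.
have [j kj] : exists j, M%:Z < `|tnth k j|.
  apply: contrapT => /forallNP h; move/negP: kB; apply.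
  apply/imfsetP; exists (freq_class M k) => //=.
  by rewrite freq_classK// => j; rewrite leNgt; apply/negP; exact: h.
apply: le_trans (freq_weight_ge k j); apply: ge0_ler_powR => //; rewrite ?nnegrE ?addr_ge0//.
have : (M%:Z)%:~R <= `|tnth k j|%:~R :> R by rewrite ler_int ltW.
by rewrite intr_norm -pmulrn; lra.
Qed.

Lemma measurable_cabs_sqr (g : pt R d -> R[i]) : cmeasurable g ->
  measurable_fun [set: pt R d] (fun x => cabs (g x) ^+ 2).
Proof.
move=> [mr mi]; under eq_fun do rewrite sqr_cabs.
by apply: measurable_funD; apply: measurable_funX.
Qed.

(** Monotonicity of the integral: a majorant of |g|^2 with known mean is enough, so the norm itself
    is never computed. *)
Lemma L2_norm_le (g : pt R d -> R[i]) (F : pt R d -> R) (I B : R) :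
  0 <= B -> cmeasurable g -> haar_mean F I ->
  (forall x, cabs (g x) ^+ 2 <= F x) -> I <= B ^+ 2 -> (L2_norm d g <= B%:E)%E.
Proof.
move=> B0 mg [IF EF] gF IB.
have F0 x : 0 <= F x by apply: le_trans (gF x); rewrite sqr_ge0.
have -> : B%:E = ((B ^+ 2)%:E `^ 2^-1)%E.
  by rewrite poweR_EFin -powR_mulrn// -powRrM mulfV// powRr1.
have E x : (`|(cabs (g x))%:E| `^ 2)%E = (cabs (g x) ^+ 2)%:E.
  by rewrite abse_EFin ger0_norm ?cabs_ge0// poweR_EFin -powR_mulrn ?cabs_ge0.
rewrite /L2_norm unlock; under eq_integral do rewrite E.
apply: gt0_ler_poweR => //.
- by rewrite in_itv/= leey andbT integral_ge0// => x _; rewrite lee_fin sqr_ge0.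
- by rewrite in_itv/= leey andbT lee_fin sqr_ge0.
apply: (@le_trans _ _ (\int[haar R d]_x (F x)%:E)%E).
  apply: ge0_le_integral => //.
  - by move=> x _; rewrite lee_fin sqr_ge0.
  - by apply/measurable_EFinP; exact: measurable_cabs_sqr.
  - by have /integrableP[] := IF.
  - by move=> x _; rewrite lee_fin.
rewrite -[leLHS]fineK; last exact: integrable_fin_num.
by rewrite lee_fin -[X in X <= _]/(\int[haar R d]_x F x)%R EF.
Qed.

Lemma cmeasurableB (f g : pt R d -> R[i]) : cmeasurable f -> cmeasurable g ->
  cmeasurable (fun x => f x - g x).
Proof.
move=> [fr fi] [gr gi]; split.
- under eq_fun do rewrite raddfB /=; exact: measurable_funB.
- under eq_fun do rewrite raddfB /=; exact: measurable_funB.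
Qed.

Lemma wiener_ball_cmeasurable f : wiener_ball r d f -> cmeasurable f.
Proof.
move=> [[_ [/integrableP[fr _] /integrableP[fi _]] _ _] _].
by split; apply/measurable_EFinP.
Qed.

Lemma wiener_ball_L2 f : wiener_ball r d f -> L2 d f.
Proof.
move=> bf; split; [by have [[]] := bf|exact: wiener_ball_cmeasurable|].
apply: le_lt_trans (ltry 1).
apply: (@L2_norm_le f (fun=> 1) 1 1) => //; [exact: wiener_ball_cmeasurable|exact: haar_mean_cst| |].
  by move=> x; rewrite expr_le1 ?cabs_ge0 ?wiener_ball_bounded.
by rewrite expr1n.
Qed.

(** The default output of the reconstruction in [sampling_number_le], on data that no ball function
    produces. *)
Lemma L2_zero : L2 d (fun=> 0 : R[i]).
Proof.
split; [by []|by split; exact: measurable_cst|].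
apply: le_lt_trans (ltry 0).
have m0 : cmeasurable (fun _ : pt R d => 0 : R[i]) by split; exact: measurable_cst.
apply: (L2_norm_le (lexx 0) m0 (haar_mean_cst d 0)) => [x|].
  by rewrite cabs0 expr0n.
by rewrite expr0n.
Qed.

End WienerBall.

(** * From agreement at the samples to closeness in the quadratic mean *)

Section Sampling.
Local Open Scope classical_set_scope.
Local Open Scope complex_scope.
Context {R : realType}.

Definition coef_support (U : finType) (c : U -> R[i]) : {set U} := [set u | c u != 0]%SET.

(** Coefficients whose frequencies are aliased to the same box frequency are added up; at most one
    class arises per frequency of [J]. *)
Lemma trig_sum_grid d M (c : freq d -> R[i]) (J : {fset freq d}) :
  exists c' : grid d M -> R[i], (#|coef_support c'| <= #|` J|)%N /\
    forall g, trig_sum c J (grid_pt g) = grid_sum c' g.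
Proof.
exists (fun u => \sum_(k <- J | freq_class M k == u) c k); split.
  apply: (@leq_trans #|[seq freq_class M k | k <- J]|).
    apply/subset_leq_card/fintype.subsetP => u; rewrite inE.
    apply: contraNT => uJ; rewrite big_seq_cond big_pred0// => k.
    apply/negP => /andP[kJ /eqP ku]; move/negP: uJ; apply.
    by apply/mapP; exists k.
  by rewrite (leq_trans (card_size _))// size_map.
move=> g; rewrite /trig_sum /grid_sum.
under [RHS]eq_bigr do rewrite mulr_suml.
rewrite (exchange_big_dep xpredT)//=; apply: eq_bigr => k _.
rewrite (big_pred1 (freq_class M k)); last by move=> u; rewrite eq_sym.
by rewrite grid_freq_class.
Qed.

(** A one-sided discretisation inequality for sparse grid polynomials, with the constant of
    [exists_grid_points]. *)
Definition grid_sampling d M m (n : nat) (T : 'I_m -> grid d M) :=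
  forall (c : grid d M -> R[i]) (eta : R), (#|coef_support c| <= n)%N ->
    (forall k, cabs (grid_sum c (T k)) <= eta) ->
    \sum_g cabs (grid_sum c g) ^+ 2 <= 64 * ((2 * M).+1 ^ d)%:R * eta ^+ 2.

(** Isolates what the sampling argument needs from approximation theory; both bounds of the theorem
    supply it, through [grid_approximable_best] and [box_approximable]. *)
Definition grid_approximable r d M n (eta : R) := forall f, wiener_ball r d f ->
  exists2 c : grid d M -> R[i], (#|coef_support c| <= n)%N &
    forall g, cabs (f (grid_pt g) - grid_sum c g) <= eta.

Lemma grid_sumB d M (c1 c2 : grid d M -> R[i]) g :
  grid_sum (fun u => c1 u - c2 u) g = grid_sum c1 g - grid_sum c2 g.
Proof. by rewrite -sumrB; apply: eq_bigr => u _; rewrite mulrBl. Qed.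

Lemma sqr_cabs_triangle (z w : R[i]) (e : R) : cabs (z - w) <= e ->
  cabs z ^+ 2 <= 2 * cabs w ^+ 2 + 2 * e ^+ 2.
Proof.
move=> zw; have := cabsD (z - w) w; rewrite subrK.
have := cabs_ge0 z; have := cabs_ge0 w; have := cabs_ge0 (z - w).
by move: zw; move: (cabs z) (cabs w) (cabs (z - w)) => x y u; have := sqr_ge0 (u - y); nra.
Qed.

(** The difference [D] of the sparse approximants is within 2 eta of f - g on the grid, hence at
    most 2 eta at the samples, hence small in the quadratic mean over the grid. There it is close to
    the box part [P] of f - g. Parseval on the grid bounds the coefficients of [P], and Parseval on
    the torus turns this into an L2 bound. *)
Lemma L2_norm_sampling_zero r d M m n (T : 'I_m -> grid d M) (eta : R) f g :
  0 <= r -> (0 < M)%N -> grid_sampling (2 * n) T -> 0 <= eta ->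
  grid_approximable r d M n eta -> wiener_ball r d f -> wiener_ball r d g ->
  (forall k, f (grid_pt (T k)) = g (grid_pt (T k))) ->
  (L2_norm d (fun x => (f x - g x)%R) <= (33 * (eta + M%:R `^ (- r)))%:E)%E.
Proof.
move=> r0 M0 hT eta0 happ bf bg fgT.
have [cf sf hf] := happ _ bf; have [cg sg hg] := happ _ bg.
set tau := M%:R `^ (- r); have tau0 : 0 <= tau by exact: powR_ge0.
pose N : R := ((2 * M).+1 ^ d)%:R.
have N0 : 0 < N by rewrite ltr0n expn_gt0.
pose D u := cf u - cg u.
pose a (u : grid d M) := fourier f (grid_freq u) - fourier g (grid_freq u).
pose P x := \sum_(u : grid d M) a u * character (grid_freq u) x.
have hP x : cabs (f x - g x - P x) <= 2 * tau.
  have -> : P x = \sum_(u : grid d M) fourier f (grid_freq u) * character (grid_freq u) x -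
      \sum_(u : grid d M) fourier g (grid_freq u) * character (grid_freq u) x.
    by rewrite /P -sumrB; apply: eq_bigr => u _; rewrite mulrBl.
  have := wiener_ball_box r0 x M0 bf; have := wiener_ball_box r0 x M0 bg; rewrite -/tau.
  set A := \sum_u _; set B := \sum_u _ => hA hB.
  have -> : f x - g x - (B - A) = (f x - B) - (g x - A) by ring.
  by have := cabsD (f x - B) (- (g x - A)); rewrite cabsN; lra.
have D_supp : (#|coef_support D| <= 2 * n)%N.
  have sub : coef_support D \subset coef_support cf :|: coef_support cg.
    apply/fintype.subsetP => u; rewrite !inE -negb_and; apply: contra.
    by move=> /andP[/eqP h1 /eqP h2]; rewrite /D h1 h2 subrr.
  rewrite (leq_trans (subset_leq_card sub))// (leq_trans (leq_card_setU _ _))//.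
  by apply: leq_trans (leq_add sf sg) _; lia.
have D_small k : cabs (grid_sum D (T k)) <= 2 * eta.
  rewrite grid_sumB; have := hf (T k); have := hg (T k); rewrite fgT.
  set z := g _; set A := grid_sum _ _; set B := grid_sum _ _ => hA hB.
  have -> : B - A = (z - A) - (z - B) by ring.
  by have := cabsD (z - A) (- (z - B)); rewrite cabsN; lra.
have hD := hT _ _ D_supp D_small.
(* The constant is 520 = 2 * 64 * 2^2 + 2 * 2^2, from the sampling inequality for [D] and from the
   distance 2 (eta + tau) of [P] and [D]. *)
have sum_a : \sum_u cabs (a u) ^+ 2 <= 520 * (eta + tau) ^+ 2.
  rewrite -(ler_pM2l N0) -grid_parseval.
  have pw g' : cabs (grid_sum a g') ^+ 2 <=
      2 * cabs (grid_sum D g') ^+ 2 + 2 * (2 * (eta + tau)) ^+ 2.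
    apply: sqr_cabs_triangle.
    have := hP (grid_pt g'); rewrite (grid_sumB cf cg).
    have := hf g'; have := hg g'.
    set z := f _; set w := g _; set A := grid_sum _ _; set B := grid_sum _ _.
    set C := P _ => hA hB hC.
    have -> : grid_sum a g' - (B - A) = - (z - w - C) + ((z - B) - (w - A)).
      by rewrite /C /P /grid_sum; ring.
    have := cabsD (- (z - w - C)) ((z - B) - (w - A)); rewrite cabsN.
    by have := cabsD (z - B) (- (w - A)); rewrite cabsN; lra.
  apply: le_trans (ler_sum _ (fun g' _ => pw g')) _.
  rewrite big_split /= -mulr_sumr sumr_const card_grid -[X in _ + X <= _]mulr_natl -/N.
  have : eta ^+ 2 <= (eta + tau) ^+ 2 by nra.
  move=> he; have := ler_wpM2l (ltW N0) he; move: hD; rewrite -/N; lra.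
have inj : injective (@grid_freq d M) := can_inj (@grid_freqK d M).
(* The mean of this majorant is at most (2 * 520 + 8) (eta + tau)^2, and 1048 is below 33^2. *)
have hm := haar_meanD (haar_meanZ 2 (haar_mean_parseval a inj))
  (haar_mean_cst d (2 * (2 * tau) ^+ 2)).
apply: (L2_norm_le _ _ hm).
- by rewrite mulr_ge0 ?addr_ge0.
- by apply: cmeasurableB; [exact: wiener_ball_cmeasurable bf|exact: wiener_ball_cmeasurable bg].
- by move=> x; apply: sqr_cabs_triangle; exact: hP.
- by nra.
Qed.

Lemma sampling_number_le r d M m m' n (T : 'I_m -> grid d M) (eta : R) :
  0 <= r -> (0 < M)%N -> (0 < m <= m')%N -> grid_sampling (2 * n) T -> 0 <= eta ->
  grid_approximable r d M n eta ->
  (sampling_number m' (wiener_ball r d) (L2 d) (L2_norm d)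
    <= (33 * (eta + M%:R `^ (- r)))%:E)%E.
Proof.
move=> r0 M0 /andP[m0 mm'] hT eta0 happ.
pose i0 := Ordinal m0.
(* Positions from [m] on merely repeat the first point, so any larger number of samples is
   allowed. *)
pose t : m'.-tuple (pt R d) := [tuple grid_pt (T (insubd i0 (i : nat))) | i < m'].
pose samples (f : pt R d -> R[i]) := [tuple f (tnth t i) | i < m'].
(* Any ball function with the given samples will do; for the samples of [f] there is one, namely
   [f]. *)
pose Rec (y : m'.-tuple R[i]) : pt R d -> R[i] :=
  xget (fun=> 0) [set g | wiener_ball r d g /\ samples g = y].
have RecL2 y : L2 d (Rec y).
  rewrite /Rec; case: xgetP => [g _ [bg _]|_]; last exact: L2_zero.
  exact: wiener_ball_L2 bg.
apply: le_trans (ereal_inf_lbound _) _; first by exists t.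
apply: le_trans (ereal_inf_lbound _) _; first by exists Rec.
apply: ge_ereal_sup => _ [f bf <-].
have [bg sg] : wiener_ball r d (Rec (samples f)) /\ samples (Rec (samples f)) = samples f.
  by rewrite /Rec; case: xgetP => [g _ //|/(_ f)[]].
apply: (L2_norm_sampling_zero r0 M0 hT eta0 happ bf bg) => k.
have := congr1 (fun y => tnth y (widen_ord mm' k)) sg.
rewrite /= !tnth_mktuple /=.
have -> : insubd i0 (k : nat) = k by apply: val_inj; rewrite val_insubd ltn_ord.
by move=> ->.
Qed.

End Sampling.

(** * Choice and size of the parameters *)

Section SamplingArithmetic.

Lemma up_log2_spec (n : nat) : (1 <= n)%N ->
  [/\ (0 < up_log 2 n.+1)%N, (n.+1 <= 2 ^ up_log 2 n.+1)%N &
      (2 ^ up_log 2 n.+1 <= 2 * n)%N].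
Proof.
move=> n1; have /andP[lo hi] := up_log_bounds (isT : 1 < 2)%N (n1 : 1 < n.+1)%N.
have a0 : (0 < up_log 2 n.+1)%N by rewrite up_log_gt0.
by split=> //; rewrite -(prednK a0) expnS leq_pmul2l.
Qed.

(* [J] levels, [64 * a * b] for log(m) and [2 + d * u] for the logarithm of the
   number of signed characters in [exists_grid_points]. *)
Lemma sampling_parameters (n d M : nat) :
  let a := up_log 2 n.+1 in let b := up_log 2 d.+1 in
  let u := up_log 2 (2 * M).+1 in
  let J := (a + 5)./2 in
  let m := (8 * J * 4 ^ J * (512 * (64 * a * b) * (2 + d * u) + 1))%N in
  (1 <= n)%N -> (1 <= d)%N -> (1 <= M)%N -> (M <= n.+1 ^ 3)%N ->
  [/\ (0 < J)%N, (8 * (2 * n) <= 4 ^ J)%N,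
      (4 * (2 * M).+1 ^ d <= 2 ^ (2 + d * u))%N,
      (2 * (m + 2) < 2 ^ (64 * a * b))%N &
      (m <= 8 * (3 * a) * (64 * n) * (512 * (64 * a * b) * (3 * (d * u)) * 2))%N].
Proof.
move=> a b u J m n1 d1 M1 Mn.
have [a0 na an] := up_log2_spec n1; rewrite -/a in a0 na an.
have [b0 db _] := up_log2_spec d1; rewrite -/b in b0 db.
have [u0 Mu _] := @up_log2_spec (2 * M)%N ltac:(lia); rewrite -/u in u0 Mu.
have J_le : (2 * J <= a + 5)%N by rewrite /J; lia.
have J_ge : (a + 4 <= 2 * J)%N by rewrite /J; lia.
have J3 : (J <= 3 * a)%N by lia.
have E4 : (4 ^ J = 2 ^ (2 * J))%N by rewrite expnM.
have four_le : (4 ^ J <= 32 * 2 ^ a)%N.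
  by rewrite E4 -[32%N]/(2 ^ 5)%N -expnD leq_exp2l// addnC.
have four_ge : (16 * 2 ^ a <= 4 ^ J)%N.
  by rewrite E4 -[16%N]/(2 ^ 4)%N -expnD leq_exp2l// addnC.
(* The bound M <= (n+1)^3 makes log M of order log n; only this keeps log m free of M. *)
have ua : (u <= 3 * a + 2)%N.
  apply: up_log_min => //; rewrite expnD mulnC [in leqRHS]mulnC [(3 * a)%N]mulnC expnM.
  have : (n.+1 ^ 3 <= (2 ^ a) ^ 3)%N by rewrite leq_exp2r.
  have : (0 < n.+1 ^ 3)%N by rewrite expn_gt0.
  by move: (n.+1 ^ 3)%N ((2 ^ a) ^ 3)%N Mn => x y; lia.
have aA : (a <= 2 ^ a)%N by apply: ltnW; exact: ltn_expl.
have bB : (b <= 2 ^ b)%N by apply: ltnW; exact: ltn_expl.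
have A0 : (0 < 2 ^ a)%N by rewrite expn_gt0.
have B0 : (0 < 2 ^ b)%N by rewrite expn_gt0.
have du0 : (0 < d * u)%N by rewrite muln_gt0 d1.
split=> //.
- by lia.
- by lia.
- by rewrite expnD -[4%N]/(2 ^ 2)%N leq_mul2l /= [(d * u)%N]mulnC expnM leq_exp2r.
(* The requirement is circular, as [m] contains l = 64ab. But [m] is polynomial in 2^a and 2^b: it
   is at most 2^(29 + 4a + 2b), and 31 + 4a + 2b < 64ab for positive a and b. *)
- have first_le : (8 * J * 4 ^ J <= 2 ^ 10 * (2 ^ a) ^ 2)%N.
    apply: (@leq_trans (8 * (3 * 2 ^ a) * (32 * 2 ^ a))).
      by rewrite leq_mul// leq_mul2l /= (leq_trans J3)// leq_mul2l.
    by move: (2 ^ a)%N => A; nia.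
  have second_le : (512 * (64 * a * b) * (2 + d * u) + 1 <= 2 ^ 19 * (2 ^ a * 2 ^ b) ^ 2)%N.
    have hd : (2 + d * u <= 8 * (2 ^ a * 2 ^ b))%N.
      have : (d * u <= 2 ^ b * (5 * 2 ^ a))%N by apply: leq_mul; lia.
      have : (0 < 2 ^ a * 2 ^ b)%N by rewrite muln_gt0 A0.
      by lia.
    have hl : (64 * a * b <= 64 * (2 ^ a * 2 ^ b))%N.
      by rewrite -mulnA leq_mul2l /= leq_mul.
    apply: (@leq_trans (512 * (64 * (2 ^ a * 2 ^ b)) * (8 * (2 ^ a * 2 ^ b)) + 1)).
      by rewrite leq_add2r leq_mul// leq_mul2l.
    have : (0 < 2 ^ a * 2 ^ b)%N by rewrite muln_gt0 A0.
    by move: (2 ^ a * 2 ^ b)%N => y y0; nia.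
  have mle : (m <= 2 ^ (29 + 4 * a + 2 * b))%N.
    apply: leq_trans (leq_mul first_le second_le) _.
    rewrite -expnD -!expnM -!expnD leq_exp2l//; lia.
  have two_le : (2 <= 2 ^ (29 + 4 * a + 2 * b))%N by rewrite -{1}[2%N]/(2 ^ 1)%N leq_exp2l.
  apply: (@leq_ltn_trans (2 ^ (31 + 4 * a + 2 * b))).
    rewrite -[(31 + _ + _)%N]/(2 + (29 + 4 * a + 2 * b))%N expnD.
    by move: mle two_le; move: (2 ^ (29 + 4 * a + 2 * b))%N => z; lia.
  have : (a <= a * b)%N by rewrite leq_pmulr.
  have : (b <= a * b)%N by rewrite leq_pmull.
  by rewrite ltn_exp2l// -mulnA; lia.
- apply: leq_mul.
    by rewrite leq_mul// ?leq_mul2l// (leq_trans four_le)//; lia.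
  have l0 : (0 < 64 * a * b)%N by rewrite !muln_gt0 a0 b0.
  have : (512 * (64 * a * b) * (2 + d * u) <= 512 * (64 * a * b) * (3 * (d * u)))%N.
    by rewrite leq_mul2l; lia.
  have : (0 < 512 * (64 * a * b) * (3 * (d * u)))%N by rewrite !muln_gt0 a0 b0 d1 u0.
  by lia.
Qed.

Context {R : realType}.

(** [expR_le_quadratic] at 1/2 says that the square root of e is at most 2. *)
Lemma ln2_ge_half : 2^-1 <= ln 2 :> R.
Proof.
rewrite -[leLHS]expRK ler_ln ?posrE ?expR_gt0//.
by apply: le_trans (expR_le_quadratic _) _ => //; lra.
Qed.

Lemma exponent_le_ln (a k N : nat) : (0 < N)%N -> (2 ^ a <= N ^ k)%N ->
  a%:R <= 2 * k%:R * ln N%:R :> R.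
Proof.
move=> N0; rewrite -(ler_nat R) !natrX => h.
have N0' : 0 < N%:R :> R by rewrite ltr0n.
have : ln (2 ^+ a) <= ln (N%:R ^+ k) :> R.
  by rewrite ler_ln ?posrE ?exprn_gt0.
rewrite !lnXn// -[ln 2 *+ a]mulr_natl -[ln _ *+ k]mulr_natl.
have := ler_wpM2l (ler0n R a) ln2_ge_half; lra.
Qed.

(* The last factor comes from binary logarithms: they are at most 4, 4 and 6
   times ln (n + 1), ln (d + 1) and ln M, the first one being squared. *)
Definition sampling_constant : R := (8 * 3 * 64) * (512 * 64 * 3 * 2) * (16 * 4 * 6).

Lemma sampling_parameters_real (n d M : nat) :
  let a := up_log 2 n.+1 in let b := up_log 2 d.+1 in
  let u := up_log 2 (2 * M).+1 in
  (1 <= n)%N -> (1 <= d)%N -> (3 <= M)%N ->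
  (8 * (3 * a) * (64 * n) * (512 * (64 * a * b) * (3 * (d * u)) * 2))%:R <=
  sampling_constant * d%:R * ln (d%:R + 1) * n%:R * ln (n%:R + 1) ^+ 2 * ln M%:R.
Proof.
move=> a b u n1 d1 M3.
have log_le k : (1 <= k)%N -> (up_log 2 k.+1)%:R <= 4 * ln (k%:R + 1) :> R.
  move=> k1; have [_ _ h] := up_log2_spec k1; rewrite natr1.
  have := @exponent_le_ln (up_log 2 k.+1) 2 k.+1 isT.
  rewrite -natrM; apply; apply: leq_trans h _; nia.
have ha : a%:R <= 4 * ln (n%:R + 1) :> R by exact: (log_le n n1).
have hb : b%:R <= 4 * ln (d%:R + 1) :> R by exact: (log_le d d1).
have hu : u%:R <= 6 * ln M%:R :> R.
  have [_ _ h] := @up_log2_spec (2 * M)%N ltac:(lia).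
  have := @exponent_le_ln u 3 M ltac:(lia).
  rewrite -natrM; apply; apply: leq_trans h _; rewrite expnSr -mulnn; nia.
have -> : (8 * (3 * a) * (64 * n) * (512 * (64 * a * b) * (3 * (d * u)) * 2))%:R =
    (8 * 3 * 64) * (512 * 64 * 3 * 2) * (n%:R * d%:R) * (a%:R ^+ 2 * (b%:R * u%:R)) :> R.
  by rewrite !natrM; ring.
have -> : sampling_constant * d%:R * ln (d%:R + 1) * n%:R * ln (n%:R + 1) ^+ 2 * ln M%:R
  = (8 * 3 * 64) * (512 * 64 * 3 * 2) * (n%:R * d%:R) * ((4 * ln (n%:R + 1)) ^+ 2 *
    ((4 * ln (d%:R + 1)) * (6 * ln M%:R))) :> R.
  by rewrite /sampling_constant; ring.
have : 0 <= (8 * 3 * 64) * (512 * 64 * 3 * 2) :> R by lra.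
move: ((8 * 3 * 64) * (512 * 64 * 3 * 2)) => K K0.
apply: ler_wpM2l; first by rewrite !mulr_ge0.
apply: ler_pM; rewrite ?mulr_ge0 ?exprn_ge0//.
  by rewrite lerXn2r ?nnegrE// (le_trans _ ha).
by apply: ler_pM.
Qed.

End SamplingArithmetic.

Section SamplingBound.
Context {R : realType}.

Lemma sampling_number_bound (r : R) (d n M m : nat) (eta : R) :
  0 <= r -> (1 <= d)%N -> (1 <= n)%N -> (3 <= M)%N -> (M <= n.+1 ^ 3)%N -> 0 <= eta ->
  grid_approximable r d M n eta ->
  sampling_constant * d%:R * ln (d%:R + 1) * n%:R * ln (n%:R + 1) ^+ 2 * ln M%:R <= m%:R :> R ->
  (sampling_number m (wiener_ball r d) (L2 d) (L2_norm d)
    <= (33 * (eta + M%:R `^ (- r)))%:E)%E.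
Proof.
move=> r0 d1 n1 M3 Mn eta0 happ hm.
have M0 : (0 < M)%N by lia.
have [J0 hn hb hl hml] := sampling_parameters n1 d1 M0 Mn.
have [T hT] := @exists_grid_points R d M _ _ _ _ _ J0 hb hl (leqnn _) hn.
apply: (sampling_number_le r0 M0 _ hT eta0 happ).
apply/andP; split; first by rewrite !muln_gt0 J0 expn_gt0 addn1.
rewrite -(ler_nat R); apply: le_trans hm; apply: le_trans (sampling_parameters_real n1 d1 M3).
by rewrite ler_nat.
Qed.

End SamplingBound.

(** * Comparison with best n-term approximation *)

Section BestApproximation.
Local Open Scope classical_set_scope.
Local Open Scope complex_scope.
Context {R : realType}.

(** The inequality is strict because the infimum over n-term sums need not be attained. Aliasing
    brings an arbitrary n-term sum into the box without changing it on the grid. *)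
Lemma grid_approximable_best r d M n (s : R) :
  (best_n_term n (wiener_ball r d) < s%:E)%E -> grid_approximable r d M n s.
Proof.
move=> hs f bf.
have : (ereal_inf [set Linf_norm (fun x => (f x - trig_sum Jc.2 Jc.1 x)%R) |
    Jc in [set Jc : {fset freq d} * (freq d -> R[i]) | (#|` Jc.1| <= n)%N]] < s%:E)%E.
  by apply: le_lt_trans hs; apply: ereal_sup_ubound; exists f.
move=> /ereal_inf_lt[_ [[J c] /= Jn <-] hL].
have [c' [c'J hc]] := trig_sum_grid M c J.
exists c'; first exact: leq_trans c'J Jn.
move=> g; rewrite -hc -lee_fin; apply: le_trans (ltW hL).
by apply: ereal_sup_ubound; exists (grid_pt g).
Qed.

Lemma trig_sum_zperiodic d (c : freq d -> R[i]) J : zperiodic (trig_sum c J).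
Proof.
move=> x l; rewrite /trig_sum; apply: eq_bigr => k _; congr (_ * _).
rewrite /character -[RHS]mul1r -(expi_2pi_int (\sum_j tnth k j * tnth l j)) -expiD.
congr expi; rewrite -mulrDr; congr (_ * _).
rewrite /dotp rmorph_sum -big_split /=; apply: eq_bigr => j _.
by rewrite tnth_mktuple rmorphM /= mulrDr addrC.
Qed.

Lemma trig_sum_wiener_ball r d (c : freq d -> R[i]) (J : {fset freq d}) :
  \sum_(k <- J) cabs (c k) * freq_weight r k <= 1 -> wiener_ball r d (trig_sum c J).
Proof.
move=> cJ; have norm_le : (wiener_norm r (trig_sum c J) <= 1)%E.
  rewrite /wiener_norm; apply: ge_ereal_sup => _ [X [finX _] <-].
  rewrite fsbig_finite//= sumEFin lee_fin; set X' := fset_set X.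
  apply: le_trans cJ.
  under eq_bigr do rewrite fourier_trig_sum -/(freq_weight r _).
  pose F k := cabs (if k \in J then c k else 0) * freq_weight r k.
  rewrite -/(F _).
  have F0 k : 0 <= F k.
    by rewrite mulr_ge0 ?cabs_ge0// prodr_ge0// => j _; exact: powR_ge0.
  rewrite (big_fsetID _ (mem J))/= [X in _ + X]big_seq [X in _ + X]big1 ?addr0; last first.
    by move=> k; rewrite !inE => /andP[_ /negbTE kJ]; rewrite /F kJ cabs0 mul0r.
  have -> : \sum_(k <- J) cabs (c k) * freq_weight r k = \sum_(k <- J) F k.
    by rewrite big_seq [RHS]big_seq; apply: eq_bigr => k kJ; rewrite /F kJ.
  rewrite [leRHS](big_fsetID _ (mem X'))/=.
  have -> : [fset k in X' | k \in J]%fset = [fset k in J | k \in X']%fset.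
    by apply/fsetP => k; rewrite !inE andbC.
  by rewrite lerDl sumr_ge0.
split; last exact: norm_le.
split; [exact: trig_sum_zperiodic|exact: cintegrable_trig_sum|exact: le_lt_trans norm_le (ltry _)|].
move=> x.
have FF : Filter (@totally (freq d)) by case: (@totally_filter (freq d)).
apply/(@cvgrPdist_lt R[i] R[i]^o) => e e0.
(* The partial sums of the Fourier series are constant as soon as the index set contains [J]. *)
exists J => // B /= JB.
have -> : trig_sum (fourier (trig_sum c J)) B x = trig_sum c J x; last by rewrite subrr normr0.
rewrite {1}/trig_sum (big_fsetID _ (mem J))/=.
rewrite [X in _ + X]big_seq [X in _ + X]big1 ?addr0; last first.
  by move=> k; rewrite !inE => /andP[_ /negbTE kJ]; rewrite fourier_trig_sum kJ mul0r.
have -> : [fset k in B | k \in J]%fset = J.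
  apply/fsetP => k; rewrite !inE; have [kJ|] := boolP (k \in J); last by rewrite andbF.
  by rewrite (fsubsetP JB).
by rewrite /trig_sum big_seq [RHS]big_seq; apply: eq_bigr => k kJ; rewrite fourier_trig_sum kJ.
Qed.

(* The witness is a multiple of a sum of n + 1 characters: an n-term combination
   cannot meet all of their frequencies, so it misses one Fourier coefficient. *)
Lemma best_n_term_ge (r : R) d n : 0 <= r -> (1 <= d)%N ->
  ((n.+1%:R `^ (- (1 + r)))%:E <= best_n_term n (wiener_ball r d))%E.
Proof.
(* The n + 1 frequencies are 0, ..., n in the first coordinate and 0 elsewhere. Each weight is at
   most (n+1)^r, so the factor [beta] puts the sum into the unit ball. *)
case: d => // d r0 _; set beta := n.+1%:R `^ _.
pose fr (i : 'I_n.+1) : freq d.+1 := [tuple if j == ord0 then (i : nat)%:Z else 0 | j < d.+1].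
have fr_inj : injective fr.
  move=> i j /(congr1 (fun k => tnth k ord0)); rewrite !tnth_mktuple eqxx => -[ij].
  exact: val_inj.
have fr_le i j : `|tnth (fr i) j| <= n%:Z.
  by rewrite tnth_mktuple; case: ifP => // _; have := ltn_ord i; lia.
pose J := [fset fr i | i : 'I_n.+1]%fset.
have sumJ (V : zmodType) (F : freq d.+1 -> V) : \sum_(k <- J) F k = \sum_i F (fr i).
  by rewrite /J big_imfset/= ?big_enum// => i j _ _; exact: fr_inj.
have n0 : 0 < n.+1%:R :> R by rewrite ltr0n.
have beta0 : 0 < beta by rewrite powR_gt0.
pose f : pt R d.+1 -> R[i] := trig_sum (fun=> beta%:C) J.
have bf : wiener_ball r d.+1 f.
  apply: trig_sum_wiener_ball; rewrite sumJ.
  apply: (@le_trans _ _ (\sum_(i < n.+1) beta * n.+1%:R `^ r)).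
    apply: ler_sum => i _; rewrite cabs_real gtr0_norm// ler_wpM2l ?(ltW beta0)//.
    rewrite /freq_weight big_ord_recl big1 ?mulr1 => [|j _]; last first.
      by rewrite tnth_mktuple /= normr0 addr0 powR1.
    rewrite tnth_mktuple eqxx. apply: ge0_ler_powR => //; rewrite ?nnegrE ?addr_ge0//.
    by rewrite -pmulrn normr_nat nat1r ler_nat ltn_ord.
  have -> : \sum_(i < n.+1) beta * n.+1%:R `^ r = beta * (n.+1%:R * n.+1%:R `^ r).
    by rewrite sumr_const card_ord -[LHS]mulr_natl mulrCA.
  have -> : n.+1%:R * n.+1%:R `^ r = n.+1%:R `^ (1 + r) :> R.
    by rewrite powRD ?powRr1// implybE (gt_eqF n0) orbT.
  by rewrite /beta powRN mulVf// gt_eqF// powR_gt0.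
apply: le_trans (ereal_sup_ubound _); last by exists f.
apply: le_ereal_inf_tmp => _ [[J' c] /= J'n <-].
have [c' [c'J hc]] := trig_sum_grid n c J'.
(* On the grid with Q = 2n + 1 the frequencies of [f] stay distinct, and the aliased competitor has
   at most n nonzero coefficients. *)
have [i ci] : exists i, c' (freq_class n (fr i)) = 0.
  apply: contrapT => /forallNP h.
  have : (#|[set freq_class n (fr i) | i : 'I_n.+1]| <= #|coef_support c'|)%N.
    apply/subset_leq_card/fintype.subsetP => u /imsetP[i _ ->].
    by rewrite inE; apply/eqP; exact: h.
  rewrite card_imset ?card_ord => [h'|i j ij].
    by have := leq_trans h' (leq_trans c'J J'n); rewrite ltnn.
  apply: fr_inj; transitivity (grid_freq (freq_class n (fr i))).
    by rewrite freq_classK.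
  by rewrite ij freq_classK.
rewrite leNgt; apply/negP => lt_beta.
pose N : R := ((2 * n).+1 ^ d.+1)%:R.
have N0 : 0 < N by rewrite ltr0n expn_gt0.
pose e g := f (grid_pt g) - grid_sum c' g.
have e_lt g : cabs (e g) < beta.
  rewrite -lte_fin; apply: le_lt_trans lt_beta.
  by rewrite /e -hc; apply: ereal_sup_ubound; exists (grid_pt g).
have ch j (g : grid d.+1 n) : character (fr j) (grid_pt g) =
    character (grid_freq (freq_class n (fr j))) (grid_pt g) :> R[i].
  by rewrite grid_freq_class.
pose w (g : grid d.+1 n) : R[i] := conjc (character (grid_freq (freq_class n (fr i))) (grid_pt g)).
have orth j : \sum_g character (fr j) (grid_pt g) * w g =
    ((j == i) * (2 * n).+1 ^ d.+1)%:R.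
  under eq_bigr do rewrite ch; rewrite grid_orthogonal; congr ((_ * _)%:R).
  congr nat_of_bool; apply/eqP/eqP => [E|->//]; apply: fr_inj.
  transitivity (grid_freq (freq_class n (fr j))); first by rewrite freq_classK.
  by rewrite E freq_classK.
have cw : \sum_g grid_sum c' g * w g = 0 by rewrite grid_coefficient ci mulr0.
have w1 g : cabs (w g) = 1 by rewrite /w /character -expiN cabs_expi.
move: w orth cw w1 => w orth cw w1.
(* The error has coefficient [beta] at the missed frequency, so its modulus averages to at least
   [beta] and cannot be below [beta] at every grid point. *)
have coef : \sum_g e g * w g = (N * beta)%:C.
  under eq_bigr do rewrite mulrBl.
  rewrite sumrB cw subr0 /f /trig_sum; under eq_bigr do rewrite sumJ mulr_suml.
  rewrite exchange_big /=; under eq_bigr do under eq_bigr do rewrite -mulrA.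
  under eq_bigr do rewrite -mulr_sumr orth.
  rewrite (bigD1 i)//= eqxx mul1n big1 ?addr0 => [|j /negbTE ->]; last by rewrite mul0n mulr0.
  by rewrite mulrC rmorphM /= rmorph_nat.
have : N * beta <= \sum_g cabs (e g).
  have -> : N * beta = cabs ((N * beta)%:C : R[i]) by rewrite cabs_real ger0_norm// ltW// mulr_gt0.
  rewrite -coef; apply: le_trans (cabs_sum _ _ _) _.
  by apply: ler_sum => g _; rewrite cabsM w1 mulr1.
apply/negP; rewrite -ltNge.
have -> : N * beta = \sum_(g : grid d.+1 n) beta.
  by rewrite sumr_const card_grid mulr_natl.
apply: ltr_sum => [|g _]; last exact: e_lt.
by apply/hasP; exists (freq_class n (fr i)) => //; rewrite mem_index_enum.
Qed.

End BestApproximation.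

Section FirstBound.
Context {R : realType}.

Lemma nat_ceil_ge (x : R) : 0 <= x -> x <= (nat_ceil x)%:R.
Proof.
move=> x0; rewrite /nat_ceil natr_absz ger0_norm ?ceil_ge//.
by rewrite -(ler_int R) (le_trans _ (ceil_ge x)).
Qed.

Lemma sampling_constant_gt0 : 0 < sampling_constant :> R.
Proof. by rewrite /sampling_constant; lra. Qed.

(** The sampling bound is applied with M' = min(M, (n+1)^3) and eta = sigma_n + M^-r. If the cap is
    active, M'^-r = (n+1)^(-3r) is at most (n+1)^(-1-r) because r > 1/2, and [best_n_term_ge]
    absorbs it into sigma_n. Both terms are then at most eta, whence 66 = 2 * 33. *)
Lemma sampling_number_best_n_term (r : R) (d n M : nat) :
  2^-1 < r -> (1 <= d)%N -> (1 <= n)%N -> (3 <= M)%N ->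
  (sampling_number
    (nat_ceil (@sampling_constant R * d%:R * ln (d%:R + 1) * n%:R * ln (n%:R + 1) ^+ 2 * ln M%:R))
    (wiener_ball r d) (L2 d) (L2_norm d)
   <= 66%:E * (best_n_term n (wiener_ball r d) + (M%:R `^ (- r))%:E))%E.
Proof.
move=> hr d1 n1 M3.
have r0 : 0 <= r by lra.
have lnk k : (1 <= k)%N -> 0 <= ln k%:R :> R by move=> k1; rewrite ln_ge0// ler1n.
have lnk1 k : 0 <= ln (k%:R + 1) :> R by rewrite natr1 lnk.
pose M' := minn M (n.+1 ^ 3).
have n8 : (8 <= n.+1 ^ 3)%N by rewrite -[8%N]/(2 ^ 3)%N leq_exp2r.
have M'3 : (3 <= M')%N by rewrite leq_min M3 (leq_trans _ n8).
have M'0 : 0 < M'%:R :> R by rewrite ltr0n; lia.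
have pos : 0 <= sampling_constant * d%:R * ln (d%:R + 1) * n%:R * ln (n%:R + 1) ^+ 2 :> R.
  have := sampling_constant_gt0; move: (@sampling_constant R) => K /ltW K0.
  by rewrite !mulr_ge0 ?exprn_ge0.
set X := sampling_constant * _ * _ * _ * _ in pos *.
have hm : X * ln M'%:R <= (nat_ceil (X * ln M%:R))%:R.
  apply: (@le_trans _ _ (X * ln M%:R)).
    rewrite ler_wpM2l// ler_ln ?posrE ?ltr0n ?ler_nat ?geq_minl//; lia.
  by rewrite nat_ceil_ge// mulr_ge0// lnk//; lia.
have := @best_n_term_ge R r d n r0 d1.
case E : (best_n_term _ _) => [s| |] lo; last by [].
  2: by rewrite addye// gt0_muley// ?leey// lte_fin.
rewrite lee_fin in lo.
set tau := M%:R `^ (- r); have tau0 : 0 < tau by rewrite powR_gt0// ltr0n; lia.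
have s0 : 0 <= s by apply: le_trans lo; exact: powR_ge0.
have happ : grid_approximable r d M' n (s + tau).
  by apply: grid_approximable_best; rewrite E lte_fin ltrDl.
have tau' : M'%:R `^ (- r) <= s + tau.
  rewrite /M' /minn; case: ifP => _; first by rewrite lerDr.
  rewrite natrX -powR_mulrn ?ler0n// -powRrM.
  apply: (@le_trans _ _ s); last by rewrite lerDl ltW.
  apply: le_trans lo; rewrite ler_powR ?ler1n//; lra.
apply: le_trans (sampling_number_bound r0 d1 n1 M'3 (geq_minr _ _) _ happ hm) _.
  by rewrite addr_ge0// ltW.
by rewrite -EFinD -EFinM lee_fin; lra.
Qed.

End FirstBound.

(** * Hyperbolic crosses and the decay rate *)

Section HyperbolicCross.
Local Open Scope complex_scope.
Context {R : realType}.

(** Induction with ln(1 - 1/(m+2)) <= - 1/(m+2). *)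
Lemma harmonic_le (m : nat) : \sum_(t < m.+1) (t.+1%:R)^-1 <= 1 + ln m.+1%:R :> R.
Proof.
elim: m => [|m IH]; first by rewrite big_ord1 invr1 ln1 addr0.
rewrite big_ord_recr /=; have m1 : 0 < m.+1%:R :> R by rewrite ltr0n.
have m2 : 0 < m.+2%:R :> R by rewrite ltr0n.
suff : ln m.+1%:R - ln m.+2%:R <= - (m.+2%:R)^-1 :> R.
  move: IH; move: (\sum_(t < m.+1) _) (ln m.+1%:R) (ln m.+2%:R) ((m.+2%:R)^-1).
  by move=> x y z t; lra.
rewrite -ln_div ?posrE//.
have -> : m.+1%:R / m.+2%:R = 1 + - (m.+2%:R)^-1 :> R.
  apply: (mulIf (lt0r_neq0 m2)); rewrite mulfVK ?lt0r_neq0// mulrDl mul1r mulNr.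
  by rewrite mulVf ?lt0r_neq0// -[m.+2%:R]natr1 addrK.
by apply: le_ln1Dx; rewrite ltrN2 invf_lt1// ltr1n.
Qed.

(** The modulus of the frequency coordinate a - M that the index [a] stands for. *)
Definition center_dist (M : nat) (a : 'I_(2 * M).+1) : nat := `|(a : nat)%:Z - M%:Z|%N.

Lemma card_center_dist_le (M s : nat) :
  (#|[set a : 'I_(2 * M).+1 | (center_dist a < s)%N]| <= 2 * s)%N.
Proof.
case: s => [|s].
  by rewrite leqn0 cards_eq0; apply/eqP/setP => a; rewrite !inE.
pose h (a : 'I_(2 * M).+1) := ((M <= a)%N, inord (center_dist a) : 'I_s.+1).
rewrite -(@card_in_imset _ _ h).
  by rewrite (leq_trans (max_card _))// card_prod card_bool card_ord.
move=> a b; rewrite !inE => ha hb [sab /(congr1 (@nat_of_ord _))]; rewrite !inordK// => dab.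
by apply: val_inj => /=; move: sab dab; rewrite /center_dist; lia.
Qed.

Lemma sum_center_dist_le (M : nat) :
  \sum_(a : 'I_(2 * M).+1) ((center_dist a).+1%:R)^-1 <= 2 * (1 + ln M.+1%:R) :> R.
Proof.
have dM (a : 'I_(2 * M).+1) : (center_dist a < M.+1)%N.
  by have := ltn_ord a; rewrite /center_dist; lia.
pose h (a : 'I_(2 * M).+1) := ((M <= a)%N, inord (center_dist a) : 'I_M.+1).
have h_inj : {in [set: 'I_(2 * M).+1]%SET &, injective h}.
  move=> a b _ _ [sab /(congr1 (@nat_of_ord _))]; rewrite !inordK// => dab.
  by apply: val_inj => /=; move: sab dab; rewrite /center_dist; lia.
pose G (y : bool * 'I_M.+1) : R := (y.2.+1%:R)^-1.
have G0 y : 0 <= G y by rewrite invr_ge0.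
apply: (@le_trans _ _ (\sum_y G y)).
  apply: (@le_trans _ _ (\sum_(y in h @: [set: 'I_(2 * M).+1]%SET) G y)).
    rewrite big_imset//= le_eqVlt; apply/orP; left; apply/eqP.
    by apply: eq_big => [a|a _]; rewrite ?inE// /G /= inordK.
  by rewrite big_mkcond; apply: ler_sum => y _; case: ifP.
rewrite -(pair_bigA _ (fun (b : bool) (t : 'I_M.+1) => (t.+1%:R)^-1)) /= big_bool /=.
by rewrite -mulr2n -[leLHS]mulr_natl ler_wpM2l// harmonic_le.
Qed.

(** The Wiener weight for r = 1; its sublevel sets are the hyperbolic crosses. *)
Definition cross_weight d M (u : grid d M) : R := \prod_j (center_dist (u j)).+1%:R.

Lemma cross_weightE r d M (u : grid d M) :
  freq_weight r (grid_freq u) = cross_weight u `^ r.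
Proof.
rewrite /freq_weight /cross_weight.
apply: (@eq_trans _ _ (\prod_j ((center_dist (u j)).+1%:R : R) `^ r)).
  apply: eq_bigr => j _; rewrite tnth_mktuple /center_dist; congr (_ `^ _).
  by rewrite -intr_norm -[RHS]nat1r; congr (_ + _); rewrite -natr_absz.
suff [] : \prod_j ((center_dist (u j)).+1%:R : R) `^ r =
  (\prod_j (center_dist (u j)).+1%:R) `^ r /\ 0 <= \prod_j (center_dist (u j)).+1%:R :> R by [].
elim/big_rec2: _ => [|j x y _ [-> x0]]; first by rewrite powR1.
by rewrite powRM// mulr_ge0.
Qed.

Lemma card_hyperbolic_cross d M (T : R) : 0 < T ->
  #|[set u : grid d.+1 M | (cross_weight u <= T)%R]|%:R
    <= 2 * T * (2 * (1 + ln M.+1%:R)) ^+ d.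
Proof.
move=> T0; set H := finset _.
(* Fixing all coordinates but one, the first coordinate has at most
   2 T / cross_weight v values; this saves one logarithm over Rankin's bound. *)
pose rest (u : grid d.+1 M) : grid d M := [ffun j => u (lift ord0 j)].
have weightS u : cross_weight u = (center_dist (u ord0)).+1%:R * cross_weight (rest u).
  by rewrite /cross_weight big_ord_recl; congr (_ * _); apply: eq_bigr => j _; rewrite ffunE.
have w0 d' (v : grid d' M) : 0 < cross_weight v by apply: prodr_gt0 => j _; rewrite ltr0n.
have fib v : (#|[set u in H | rest u == v]|)%:R <= 2 * T / cross_weight v.
  pose y := T / cross_weight v.
  have y0 : 0 <= y by rewrite divr_ge0 ?ltW.
  (* With the integer part, [center_dist a + 1 <= y] becomes [center_dist a < s], and at most 2s <=
     2y indices remain. *)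
  pose s := Num.truncn y.
  have sy : s%:R <= y by rewrite truncn_le.
  have : (#|[set u in H | rest u == v]| <= #|[set a : 'I_(2 * M).+1 | (center_dist a < s)%N]|)%N.
    rewrite -(@card_in_imset _ _ (fun u : grid d.+1 M => u ord0)); last first.
      move=> u1 u2; rewrite !inE => /andP[_ /eqP r1] /andP[_ /eqP r2] e0.
      apply/ffunP => j; case: (unliftP ord0 j) => [i ->|->//].
      by have := congr1 (fun w : grid d M => w i) (etrans r1 (esym r2)); rewrite !ffunE.
    apply/subset_leq_card/fintype.subsetP => a /imsetP[u]; rewrite !inE.
    move=> /andP[uH /eqP uv] ->.
    by rewrite truncn_ge_nat// /y ler_pdivlMr// -uv -weightS.
  move=> /leq_trans/(_ (card_center_dist_le _ _)); rewrite -(ler_nat R) natrM.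
  move/le_trans; apply; rewrite -mulrA ler_wpM2l//.
have -> : #|H|%:R = \sum_v (#|[set u in H | rest u == v]|)%:R :> R.
  rewrite -sum1_card (partition_big rest xpredT)//= natr_sum.
  apply: eq_bigr => v _; rewrite -sum1_card; congr (_%:R).
  by apply: eq_bigl => u; rewrite inE.
apply: le_trans (ler_sum _ (fun v _ => fib v)) _.
rewrite -mulr_sumr ler_wpM2l//; first by rewrite mulr_ge0 ?ltW.
under eq_bigr do rewrite /cross_weight -prodfV.
rewrite (sum_ffun_prod d (fun a : 'I_(2 * M).+1 => ((center_dist a).+1%:R : R)^-1)).
have S0 : 0 <= \sum_(a : 'I_(2 * M).+1) ((center_dist a).+1%:R : R)^-1.
  by apply: sumr_ge0 => a _; rewrite invr_ge0.
rewrite lerXn2r ?nnegrE ?sum_center_dist_le//.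
by apply: le_trans S0 _; exact: sum_center_dist_le.
Qed.

End HyperbolicCross.

(** * Sparse approximation of ball functions on the grid *)

Section SparseApproximation.
Local Open Scope complex_scope.
Context {R : realType}.

(** Maurey's argument with weight 1 at every point: a bad set of total weight below 1 is empty. The
    average of s signed characters has at most s frequencies. The factor 2 in the error adds real
    and imaginary parts; the factor 4 in the hypothesis counts these two parts and two tails. *)
Lemma exists_sparse_grid_sum d M (c : grid d M -> R[i]) (s : nat) (delta A : R) :
  (0 < s)%N -> 0 <= delta <= 4 -> \sum_u cabs1 (c u) <= A ->
  (4 * (2 * M).+1 ^ d)%:R * expR (- (s%:R * delta ^+ 2 / 32)) < 1 ->
  exists2 c' : grid d M -> R[i], (#|coef_support c'| <= s)%N &
    forall g, cabs (grid_sum c g - grid_sum c' g) <= 2 * A * delta.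
Proof.
move=> s0 d04 cA small; have /andP[d0 _] := d04.
pose B := \sum_u cabs1 (c u); rewrite -/B in cA.
have B0 : 0 <= B by apply: sumr_ge0 => u _; exact: cabs1_ge0.
have A0 : 0 <= A by exact: le_trans cA.
have [Bz|Bn] := eqVneq B 0.
  exists (fun=> 0).
    by rewrite eq_card0// => u; rewrite !inE eqxx.
  have c0 := sum_cabs1_eq0 Bz.
  move=> g; have -> : grid_sum c g = grid_sum (fun=> 0) g.
    by apply: eq_bigr => u _; rewrite c0.
  by rewrite subrr cabs0 !mulr_ge0.
have Bp : 0 < B by rewrite lt_neqAle eq_sym Bn.
pose X := (grid d M * bool)%type.
have [p [p0 p1 hE]] := grid_sum_convex Bp; rewrite -/B in hE.
have q1 (x : X) : 0 <= (1 : R) by [].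
have small' : (\sum_(x : X) (1 : R)) * (2 * expR (- (s%:R * delta ^+ 2 / 32))) < 1.
  apply: le_lt_trans small; rewrite sumr_const card_prod card_grid card_bool.
  by rewrite mulrA ler_wpM2r ?expR_ge0// -natrM ler_nat; lia.
have [w hw] := maurey_approx (@dictionary_le1 _ d M) p0 p1 q1 s0 d04 small'.
have good x : `|s%:R^-1 * (\sum_l dictionary (w l) x) - \sum_i p i * dictionary i x| <= delta.
  rewrite leNgt; apply/negP => bx; move: hw; rewrite ltNge => /negP; apply.
  rewrite (bigD1 x)//= bx mul1r lerDl sumr_ge0//.
have [k kE] : exists k : R[i], k = (B / s%:R)%:C by exists (B / s%:R)%:C.
pose c' (u : grid d M) : R[i] := k * \sum_(l | (w l).1 == u) direction (w l).2.
have c'E g : grid_sum c' g =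
    k * \sum_l direction (w l).2 * character (grid_freq (w l).1) (grid_pt g).
  rewrite /grid_sum; under eq_bigr do rewrite /c' -mulrA mulr_suml.
  rewrite -mulr_sumr (exchange_big_dep xpredT)//=; congr (_ * _).
  by apply: eq_bigr => l _; rewrite (big_pred1 (w l).1).
exists c'.
  apply: (@leq_trans #|[set (w l).1 | l : 'I_s]|); last first.
    by rewrite (leq_trans (leq_imset_card _ _))// card_ord.
  apply/subset_leq_card/fintype.subsetP => u; rewrite inE.
  apply: contraR => hu; rewrite /c' big_pred0 ?mulr0 ?eqxx// => l.
  by apply: contraNF hu => /eqP <-; apply/imsetP; exists l.
move=> g.
have key b : `|part b (grid_sum c g - grid_sum c' g)| <= A * delta.
  have := good (g, b); rewrite hE /dictionary /= -part_sum.
  have -> : part b (grid_sum c g - grid_sum c' g) =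
      B * (part b (grid_sum c g) / B - s%:R^-1 *
        part b (\sum_l direction (w l).2 * character (grid_freq (w l).1) (grid_pt g))).
    rewrite c'E kE.
    have -> (z1 z2 : R[i]) : part b (z1 - z2) = part b z1 - part b z2.
      by case: z1 z2 => ? ? [? ?]; case: b.
    rewrite part_scale; field.
    by rewrite Bn pnatr_eq0 -lt0n s0.
  rewrite normrM (ger0_norm B0) distrC => h.
  by apply: ler_pM.
apply: le_trans (cabs_le_ReIm _) _.
by rewrite -mulrA mulr_natl mulr2n; apply: lerD; [exact: (key false)|exact: (key true)].
Qed.

Lemma ln_succ_bounds (n : nat) : (1 <= n)%N ->
  2^-1 <= ln (n%:R + 1) :> R /\ ln (n%:R + 1) <= n%:R :> R.
Proof.
move=> n1; split; last by rewrite addrC le_ln1Dx// (lt_le_trans (ltrN10 _)).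
apply: le_trans (@ln2_ge_half R) _.
by rewrite ler_ln ?posrE ?ltr_wpDl// natr1 ler_nat.
Qed.

(** With L = ln(n+1) and T = n / L^d, the cross of level T has O(n) frequencies, whose coefficients
    are kept. Beyond it the weights exceed T^r, so the remaining coefficients have l1 norm at most 2
    T^-r, and Maurey's argument with O(n) terms gains a further factor of order (L/n)^(1/2). The box
    M = (n+1)^2 contributes the first error term. *)
Lemma box_approximable (r : R) d n :
  0 <= r -> (1 <= n)%N ->
  grid_approximable r d.+1 (n.+1 ^ 2) ((2 * 10 ^ d + 32 * (4 * d.+1 + 3)) * n)
    ((n.+1 ^ 2)%:R `^ (- r) +
     4 * (n%:R / ln (n%:R + 1) ^+ d) `^ (- r) * (ln (n%:R + 1) / n%:R) `^ 2^-1).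
Proof.
move=> r0 n1; set L := ln _; set M := (n.+1 ^ 2)%N.
have [L2 Ln] := ln_succ_bounds n1; rewrite -/L in L2 Ln.
have L0 : 0 < L by lra.
have n0 : 0 < n%:R :> R by rewrite ltr0n.
have M0 : (0 < M)%N by rewrite expn_gt0.
set T := n%:R / L ^+ d; have T0 : 0 < T by rewrite divr_gt0// exprn_gt0.
set delta := (L / n%:R) `^ 2^-1.
have delta2 : delta ^+ 2 = L / n%:R.
  by rewrite -powR_mulrn ?powR_ge0// -powRrM mulVf// powRr1// divr_ge0 ?ltW.
have delta0 : 0 <= delta by exact: powR_ge0.
have delta1 : delta <= 1.
  by rewrite -(@expr_le1 _ 2)// delta2 ler_pdivrMr// mul1r.
pose H := [set u : grid d.+1 M | (cross_weight u <= T :> R)%R].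
have cardH : (#|H| <= 2 * 10 ^ d * n)%N.
  rewrite -(ler_nat R); apply: le_trans (card_hyperbolic_cross _ _ T0) _.
  apply: (@le_trans _ _ (2 * T * (10 * L) ^+ d)).
    apply: ler_wpM2l; first by apply: mulr_ge0 => //; exact: ltW.
    (* Here M + 1 <= (n+1)^3; together with 1 <= 2L this gives 2 (1 + ln(M+1)) <= 10 L. *)
    have lnM : ln M.+1%:R <= 3 * L.
      apply: (@le_trans _ _ (ln (n.+1%:R ^+ 3))).
        rewrite ler_ln ?posrE ?exprn_gt0 ?ltr0n// -natrX ler_nat /M; nia.
      by rewrite lnXn// -[leLHS]mulr_natl /L natr1.
    have lnM0 : 0 <= ln M.+1%:R :> R by rewrite ln_ge0// ler1n.
    by apply: lerXn2r; rewrite ?nnegrE; lra.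
  rewrite /T exprMn le_eqVlt; apply/orP; left; apply/eqP.
  rewrite !natrM natrX; field.
  by rewrite expf_neq0// gt_eqF.
set s := (32 * (4 * d.+1 + 3) * n)%N.
have s0 : (0 < s)%N by rewrite !muln_gt0 addn_gt0 n1 orbT.
(* [s] is chosen so that the exponential is (n+1)^-(4(d+1)+3), while the number of cases is at most
   (n+1)^(2+4(d+1)). *)
have small : (4 * (2 * M).+1 ^ d.+1)%:R * expR (- (s%:R * delta ^+ 2 / 32)) < 1 :> R.
  have -> : s%:R * delta ^+ 2 / 32 = (4 * d.+1 + 3)%:R * L.
    by rewrite delta2 /s !natrM; field; rewrite gt_eqF.
  rewrite expRN expRM_natl /L lnK ?posrE ?ltr_wpDl// ltr_pdivrMr ?exprn_gt0 ?ltr_wpDl// mul1r.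
  rewrite natr1 -natrX ltr_nat.
  apply: (@leq_ltn_trans (n.+1 ^ 2 * (n.+1 ^ 4) ^ d.+1)).
    apply: leq_mul; first by rewrite -[4%N]/(2 ^ 2)%N leq_exp2r.
    by rewrite leq_exp2r// /M; nia.
  by rewrite -expnM -expnD ltn_exp2l//; lia.
move=> f bf; pose c (u : grid d.+1 M) : R[i] := fourier f (grid_freq u).
pose c1 u := if u \in H then c u else 0.
pose c2 u := if u \in H then 0 else c u.
have sum2 : \sum_u cabs1 (c2 u) <= 2 * T `^ (- r).
  pose J := [fset @grid_freq d.+1 M u | u : grid d.+1 M]%fset.
  have : \sum_u cabs (c u) * cross_weight u `^ r <= 1.
    have := wiener_ball_sum J bf; rewrite big_imfset/=.
      by rewrite big_enum/=; under eq_bigr do rewrite cross_weightE.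
    by move=> u v _ _; exact: (can_inj (@grid_freqK d.+1 M)).
  have Tr : 0 < T `^ (- r) by rewrite powR_gt0.
  move=> h; apply: (@le_trans _ _ (2 * T `^ (- r) * \sum_u cabs (c u) * cross_weight u `^ r)).
    rewrite mulr_sumr; apply: ler_sum => u _; rewrite /c2; case: ifPn => [_|].
      by rewrite /cabs1 /= normr0 addr0 !mulr_ge0 ?cabs_ge0 ?powR_ge0.
    rewrite inE -ltNge => /ltW TW; apply: le_trans (cabs1_le _) _.
    rewrite -mulrA ler_pM2l// mulrCA ler_peMr ?cabs_ge0//.
    rewrite powRN mulrC ler_pdivlMr ?powR_gt0// mul1r.
    by apply: ge0_ler_powR => //; rewrite nnegrE ?(ltW T0)// prodr_ge0.
  by rewrite -[leRHS]mulr1 ler_wpM2l// mulr_ge0// ltW.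
have d04 : 0 <= delta <= 4 by rewrite delta0 /=; lra.
have [c3 s3 h3] := exists_sparse_grid_sum s0 d04 sum2 small.
exists (fun u => c1 u + c3 u).
  have sub : coef_support (fun u => c1 u + c3 u) \subset H :|: coef_support c3.
    apply/fintype.subsetP => u; rewrite finset.in_setU [u \in coef_support _]inE.
    by rewrite [u \in coef_support c3]inE /c1; case: ifP => //= _; rewrite add0r.
  rewrite (leq_trans (subset_leq_card sub))// (leq_trans (leq_card_setU _ _))//.
  by rewrite mulnDl leq_add.
move=> g.
have hbox := wiener_ball_box r0 (grid_pt g) M0 bf.
have -> : f (grid_pt g) - grid_sum (fun u => c1 u + c3 u) g =
  (f (grid_pt g) - grid_sum c g) + (grid_sum c2 g - grid_sum c3 g).
  have -> : grid_sum c g = grid_sum c1 g + grid_sum c2 g.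
    rewrite /grid_sum -big_split; apply: eq_bigr => u _ /=.
    by rewrite -mulrDl /c1 /c2; case: ifP; rewrite ?addr0 ?add0r.
  have -> : grid_sum (fun u => c1 u + c3 u) g = grid_sum c1 g + grid_sum c3 g.
    by rewrite /grid_sum -big_split; apply: eq_bigr => u _; rewrite mulrDl.
  by ring.
apply: le_trans (cabsD _ _) _; rewrite lerD//.
by apply: le_trans (h3 g) _; rewrite !mulrA -natrM.
Qed.

End SparseApproximation.

(** * The polynomial rate *)

Section Rate.
Context {R : realType}.

(** The sampling bound is applied with Kn terms from [box_approximable] and the box M = (n+1)^2. Its
    logarithm ln M = 2 ln(n+1) is the third logarithm in the number of samples. *)
Lemma sampling_number_rate (r : R) (d : nat) : 2^-1 < r -> (1 <= d)%N ->
  exists2 Crd : R, 0 < Crd & exists2 c : R, 0 < c &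
  forall n : nat, (1 <= n)%N ->
    (sampling_number (nat_ceil (Crd * n%:R * ln (n%:R + 1) ^+ 3))
       (wiener_ball r d) (L2 d) (L2_norm d)
     <= (c * n%:R `^ (- r - 2^-1) *
         ln (n%:R + 1) `^ ((d%:R - 1) * r + 2^-1))%:E)%E.
Proof.
case: d => // d hr _; have r0 : 0 <= r by lra.
pose K := (2 * 10 ^ d + 32 * (4 * d.+1 + 3))%N.
have K0 : (1 <= K)%N by rewrite /K; lia.
have lnK0 : 0 <= ln K%:R :> R by rewrite ln_ge0// ler1n.
have lnd : 0 < ln (d.+1%:R + 1) :> R by rewrite ln_gt0// ltrDr ltr0n.
have [B BE] : exists B : R, B = sampling_constant * d.+1%:R * ln (d.+1%:R + 1) * K%:R by eexists.
have B0 : 0 < B by rewrite BE !mulr_gt0 ?sampling_constant_gt0 ?ltr0n.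
exists (B * (2 * ln K%:R + 1) ^+ 2 * 2).
  by do 2?[apply: mulr_gt0 => //]; apply: exprn_gt0; lra.
pose p : R := (d.+1%:R - 1) * r + 2^-1.
have p0 : 0 <= p by rewrite addr_ge0// mulr_ge0// subr_ge0 ler1n.
(* M^-r occurs twice, once inside eta and once in the sampling bound; the 4 belongs to the Maurey
   term. *)
exists (33 * (2 * 2 `^ p + 4)).
  by have := powR_ge0 2 p; lra.
move=> n n1.
have [L2 Ln] := @ln_succ_bounds R n n1; set L := ln _ in L2 Ln *.
have L0 : 0 < L by lra.
have n0 : 0 < n%:R :> R by rewrite ltr0n.
set M := (n.+1 ^ 2)%N; set n1' := (K * n)%N.
have M3 : (3 <= M)%N by rewrite (@leq_trans (2 ^ 2)) ?leq_exp2r.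
have nn1 : (n <= n1')%N by rewrite leq_pmull.
have M_le : (M <= n1'.+1 ^ 3)%N.
  by rewrite (@leq_trans (n.+1 ^ 3))// ?leq_exp2l ?leq_exp2r.
have n1'0 : (1 <= n1')%N by apply: leq_trans nn1.
have happ := @box_approximable R r d n r0 n1; rewrite -/L -/M -/K -/n1' in happ.
set eta := _ + _ in happ.
have eta0 : 0 <= eta by rewrite addr_ge0 ?mulr_ge0 ?powR_ge0.
apply: le_trans (sampling_number_bound r0 _ n1'0 M3 M_le eta0 happ _) _ => //.
  set X := B * _ * _ * _ * _.
  have X0 : 0 <= X.
    have e0 : 0 <= 2 * ln K%:R + 1 :> R by lra.
    by rewrite /X !mulr_ge0// ?exprn_ge0// ?(ltW B0)// ?(ltW L0).
  apply: le_trans (nat_ceil_ge X0).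
  have logM : ln M%:R = 2 * L :> R by rewrite natrX lnXn ?ltr0n// -[LHS]mulr_natl /L natr1.
  have l0 : 0 <= ln (n1'%:R + 1) :> R by rewrite ln_ge0 ?lerDr.
  have l1 : ln (n1'%:R + 1) <= (2 * ln K%:R + 1) * L :> R.
    apply: (@le_trans _ _ (ln (K%:R * (n%:R + 1)))).
      rewrite ler_ln ?posrE ?ltr_wpDl ?mulr_gt0 ?ltr0n ?ltr_wpDl// natrM mulrDr mulr1 lerD2l ler1n//.
    rewrite lnM ?posrE ?ltr0n ?ltr_wpDl// -/L.
    by have := ler_wpM2l lnK0 L2; lra.
  have -> : X = B * n%:R * ((2 * ln K%:R + 1) * L) ^+ 2 * (2 * L) by rewrite /X; ring.
  have n1E : n1'%:R = K%:R * n%:R :> R by rewrite natrM.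
  rewrite logM; move: l0 l1; move: (ln (n1'%:R + 1)) => l l0 l1; rewrite n1E.
  have -> : sampling_constant * d.+1%:R * ln (d.+1%:R + 1) * (K%:R * n%:R) * l ^+ 2 * (2 * L)
     = B * n%:R * l ^+ 2 * (2 * L) by rewrite BE; ring.
  have le2 : l ^+ 2 <= ((2 * ln K%:R + 1) * L) ^+ 2.
    by rewrite lerXn2r ?nnegrE// (le_trans l0).
  have Bn0 : 0 <= B * n%:R by rewrite mulr_ge0// ltW.
  by apply: ler_wpM2r; [lra|exact: ler_wpM2l].
rewrite lee_fin -!mulrA ler_pM2l//.
set target := n%:R `^ _ * L `^ _.
(* As r > 1/2, (n+1)^(-2r) is at most n^(-r-1/2). The logarithmic factor of the target may be below
   1 for small n, but (2L)^p is at least 1, which explains the factor 2^p. *)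
have M_small : M%:R `^ (- r) <= 2 `^ p * target.
  rewrite natrX -powR_mulrn ?ler0n// -powRrM.
  apply: (@le_trans _ _ (n%:R `^ (- r - 2^-1))).
    apply: (@le_trans _ _ (n.+1%:R `^ (- r - 2^-1))).
      by rewrite ler_powR ?ler1n//; lra.
    have -> : - r - 2^-1 = - (r + 2^-1) by lra.
    rewrite !powRN lef_pV2 ?posrE ?powR_gt0 ?ltr0n//.
    by apply: ge0_ler_powR; rewrite ?nnegrE ?ler_nat//; lra.
  rewrite /target mulrCA -powRM ?(ltW L0)// ler_peMr ?powR_ge0//.
  by rewrite -[leLHS](powRr0 (2 * L)) ler_powR//; lra.
have main : (n%:R / L ^+ d) `^ (- r) * (L / n%:R) `^ 2^-1 = target.
  have addR (x a b : R) : 0 < x -> x `^ a * x `^ b = x `^ (a + b).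
    by move=> x0; rewrite powRD// implybE (gt_eqF x0) orbT.
  rewrite -powR_mulrn ?(ltW L0)// -powRN -[(n%:R)^-1]powR_inv1 ?ler0n//.
  rewrite !powRM ?powR_ge0 ?ler0n ?(ltW L0)// -!powRrM.
  rewrite [X in _ * X]mulrC mulrACA addR// addR// /target; congr (_ `^ _ * _ `^ _).
    by rewrite mulN1r.
  by rewrite -natr1; ring.
have target0 : 0 <= target by rewrite mulr_ge0 ?powR_ge0.
rewrite /eta -mulrA main mulrDl.
have := powR_ge0 2 p; nra.
Qed.

End Rate.

Theorem corollary4p4 (R : realType) :
  exists C Ct : R, [/\ 0 < C, 0 < Ct &
  forall (r : R) (d : nat), 2^-1 < r -> (1 <= d)%N ->
    (forall n M : nat, (1 <= n)%N -> (3 <= M)%N ->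
      (sampling_number
         (nat_ceil (C * d%:R * ln (d%:R + 1) * n%:R *
                    ln (n%:R + 1) ^+ 2 * ln M%:R))
         (wiener_ball r d) (L2 d) (L2_norm d)
       <= Ct%:E * (best_n_term n (wiener_ball r d) + (M%:R `^ (- r))%:E))%E)
    /\
    exists2 Crd : R, 0 < Crd &
    exists2 c : R, 0 < c &
    forall n : nat, (1 <= n)%N ->
      (sampling_number
         (nat_ceil (Crd * n%:R * ln (n%:R + 1) ^+ 3))
         (wiener_ball r d) (L2 d) (L2_norm d)
       <= (c * n%:R `^ (- r - 2^-1) *
           ln (n%:R + 1) `^ ((d%:R - 1) * r + 2^-1))%:E)%E].
Proof.
exists sampling_constant, 66; split => //; first exact: sampling_constant_gt0.
move=> r d hr d1; split; last exact: sampling_number_rate.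
by move=> n M n1 M3; exact: sampling_number_best_n_term.
Qed.
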